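(* Let $D$ be a convex domain in $\mathbb{C}^n$, $n\geq 2$, let $w,z\in D$, $\sigma\in\mathbb{D}\setminus\{0\}$, and let $f^1,\ldots,f^n:\mathbb{D}\to D$ be complex geodesics such that $f^1(0)=\ldots=f^n(0)=w$ and $f^1(\sigma)=\ldots=f^n(\sigma)=z$. Assume additionally that for some $\lambda\in\mathbb{D}$ the system of vectors $$\{f^1(\lambda)-f^n(\lambda),\ldots,f^{n-1}(\lambda)-f^n(\lambda)\}$$ is linearly independent over $\mathbb{C}$. Then there is only one left inverse passing through the points $w$ and $z$, i.e. there is exactly one holomorphic function $F:D\to\mathbb{D}$ such that $F\circ f=\operatorname{id}_{\mathbb{D}}$ for some (equivalently, any) complex geodesic $f:\mathbb{D}\to D$ with $f(0)=w$ and $f(\sigma)=z$.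
   Context: $\mathbb{D}$ denotes the open unit disc in $\mathbb{C}$. A holomorphic map $f:\mathbb{D}\to D$ is a complex geodesic if there is a holomorphic function $F:D\to\mathbb{D}$ with $F\circ f=\operatorname{id}_{\mathbb{D}}$; any such $F$ is called a left inverse of $f$. *)

(* Defs.v *)
(* The complex numbers are R[i] for a realType R, and C^n is the type
   'rV[R[i]]_n of row vectors.                                               *)
From HB Require Import structures.
From mathcomp Require Import all_boot all_order all_algebra.
From mathcomp Require Import complex.
From mathcomp Require Import all_classical all_reals all_analysis.
Set Implicit Arguments.
Unset Strict Implicit.
Unset Printing Implicit Defensive.
Import Order.TTheory GRing.Theory Num.Theory.
Import numFieldNormedType.Exports.
Local Open Scope classical_set_scope.
Local Open Scope ring_scope.

(* The topology and the normed space structure over itself of R[i] are found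
   only on its alias R[i]^o; these are the same structures on R[i].          *)
HB.instance Definition _ (R : realType) := GRing.ComAlgebra.copy R[i] R[i]^o.
HB.instance Definition _ (R : realType) := Vector.copy R[i] R[i]^o.
HB.instance Definition _ (R : realType) := NormedModule.copy R[i] R[i]^o.

(* The norm on R[i] takes its values in R[i], and x < y in R[i] forces y - x
   to be real: this is the usual |z| < 1.                                    *)
Definition unit_disc (R : realType) : set R[i] := [set z | `|z| < 1].
Arguments unit_disc R : clear implicits.

(* convex_set is relative to the scalars R[i]; its coefficients satisfy
   0 <= t <= 1 in R[i], hence are real: this is ordinary real convexity.     *)
Definition convex_domain (R : realType) (n : nat) (D : set 'rV[R[i]]_n) :=
  [/\ open D, connected D, D !=set0 & convex_set D].

(* Maps are total functions, constrained only on their source.  On an open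
   set U, differentiable is Frechet differentiability over R[i], that is,
   complex differentiability.                                                *)
Definition holomorphic_map (R : realType) (V W : normedModType R[i])
    (U : set V) (U' : set W) (f : V -> W) :=
  (forall x, U x -> U' (f x)) /\ (forall x, U x -> differentiable f x).

Definition holo_left_inverse (R : realType) (n : nat) (D : set 'rV[R[i]]_n)
    (f : R[i] -> 'rV[R[i]]_n) (F : 'rV[R[i]]_n -> R[i]) :=
  holomorphic_map D (unit_disc R) F /\
  (forall lambda, unit_disc R lambda -> F (f lambda) = lambda).

Definition complex_geodesic (R : realType) (n : nat) (D : set 'rV[R[i]]_n)
    (f : R[i] -> 'rV[R[i]]_n) :=
  holomorphic_map (unit_disc R) D f /\ exists F, holo_left_inverse D f F.

Definition geodesic_through (R : realType) (n : nat) (D : set 'rV[R[i]]_n)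
    (w z : 'rV[R[i]]_n) (sigma : R[i]) (f : R[i] -> 'rV[R[i]]_n) :=
  [/\ complex_geodesic D f, f 0 = w & f sigma = z].

Definition left_inverse_through (R : realType) (n : nat)
    (D : set 'rV[R[i]]_n) (w z : 'rV[R[i]]_n) (sigma : R[i])
    (F : 'rV[R[i]]_n -> R[i]) :=
  exists2 f, geodesic_through D w z sigma f & holo_left_inverse D f F.

(* Main.v *)
(* By Schwarz's lemma, F o g = id for every left inverse F through w and z and
   every holomorphic g : disc -> D with g(0) = w and g(sigma) = z.  The values
   at a fixed lambda of all such g form a convex set on which F = lambda, so by
   the identity theorem F = lambda on the part in D of the complex affine
   subspace H_lambda spanned by f^1(lambda), ..., f^n(lambda).  At the given
   lambda0 and nearby, H_lambda is a hyperplane.  Let F, G be two left inverses,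
   p = f^n(lambda0) and x in D.  If x is not in H_lambda0, then the complex line
   through p and x meets H_lambda near p for all lambda near lambda0, in points
   where F = lambda = G that are pairwise distinct and accumulate at p; hence
   F = G on this line.

   The Schwarz lemma and the identity theorem follow from a maximum principle
   for continuous functions that are holomorphic off a finite set.  This rests
   on the mean value property of circles, obtained from Goursat's bisection
   argument in logarithmic coordinates.                                       *)
Require Import Defs.
From HB Require Import structures.
From mathcomp Require Import all_boot all_order all_algebra.
From mathcomp Require Import complex ring lra.
From mathcomp Require Import all_classical all_reals all_analysis.
Set Implicit Arguments.
Unset Strict Implicit.
Unset Printing Implicit Defensive.
Import Order.TTheory GRing.Theory Num.Theory.
Import numFieldNormedType.Exports.
Local Open Scope classical_set_scope.
Local Open Scope ring_scope.
Import ComplexField.Normc.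

(* Re and Im would otherwise denote the R[i]-valued parts of ssrnum. *)
Local Notation Re := complex.Re.
Local Notation Im := complex.Im.

(** * Divergence-free plane fields *)

(** The first fundamental theorem of calculus. Such primitives replace path integrals below: the
    flux through a side of a rectangle becomes a difference of two values. *)
Lemma is_derive_locally_exists (R : realType) (f : R -> R) (a b : R) :
  (forall x, a <= x <= b -> {for x, continuous f}) ->
  exists F : R -> R, forall x, a < x < b -> is_derive x 1 F (f x).
Proof.
move=> cf.
have fi : lebesgue_measure.-integrable `[a, b] (EFin \o f).
  apply: continuous_compact_integrable; first exact: segment_compact.
  apply: continuous_in_subspaceT => x.
  by rewrite inE/= in_itv/=; exact: cf.
exists (fun x => \int[lebesgue_measure]_(t in `[a, x]) f t)%R => x /andP[ax xb].
have fx : {for x, continuous f} by apply: cf; rewrite !ltW.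
have [|dF F'] := continuous_FTC1 xb fi _ fx; first by rewrite lte_fin.
by split; [exact: dF|rewrite -derive1E; exact: F'].
Qed.

Lemma derive_dist_le (R : realType) (f df : R -> R) (c d k : R) : c <= d ->
  (forall y, c <= y <= d -> is_derive y 1 f (df y)) ->
  (forall y, c <= y <= d -> `|df y| <= k) -> `|f d - f c| <= k * (d - c).
Proof.
move=> cd fdf dfk.
have [y||y] := MVT_segment cd (f := f) (df := df).
- rewrite in_itv/= => /andP[cy yd]; apply: fdf.
  by rewrite !ltW.
- apply: continuous_in_subspaceT => y; rewrite inE/= in_itv/= => /fdf fy.
  exact/differentiable_continuous/derivable1_diffP.
- rewrite in_itv/= => /dfk dfy ->.
  by rewrite normrM [X in _ * X]ger0_norm ?subr_ge0// ler_wpM2r ?subr_ge0.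
Qed.

Section bisection.
Variables (R : realType) (w h a0 c0 : R).
Hypotheses (w_ge0 : 0 <= w) (h_ge0 : 0 <= h).
Variable good : nat -> R -> R -> Prop.
Hypothesis good_quarters : forall k a c,
  let w' := w / 2 ^+ k.+1 in let h' := h / 2 ^+ k.+1 in
  good k.+1 a c -> good k.+1 (a + w') c -> good k.+1 a (c + h') ->
  good k.+1 (a + w') (c + h') -> good k a c.
Hypothesis good_local : forall x y, a0 <= x <= a0 + w -> c0 <= y <= c0 + h ->
  exists2 e : R, 0 < e & forall k a c,
    a <= x <= a + w / 2 ^+ k -> c <= y <= c + h / 2 ^+ k ->
    w / 2 ^+ k < e -> h / 2 ^+ k < e -> good k a c.

(** Read [good k a c] as a property of the rectangle with lower left corner (a, c) and sides w / 2^k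
    and h / 2^k. A bad rectangle has a bad quarter; nested bad quarters shrink to a point, where
    [good_local] gives a contradiction. *)
Lemma good_bisection : good 0 a0 c0.
Proof.
apply: contrapT => bad0.
(* Nesting holds in every case and only badness is conditional, so that [choice] yields a total
   successor function. *)
have step (kp : nat * (R * R)) : exists p : R * R,
    [/\ kp.2.1 <= p.1, p.1 + w / 2 ^+ kp.1.+1 <= kp.2.1 + w / 2 ^+ kp.1,
        kp.2.2 <= p.2, p.2 + h / 2 ^+ kp.1.+1 <= kp.2.2 + h / 2 ^+ kp.1
      & ~ good kp.1 kp.2.1 kp.2.2 -> ~ good kp.1.+1 p.1 p.2].
  case: kp => k [a c] /=.
  have half (l : R) : l / 2 ^+ k = l / 2 ^+ k.+1 + l / 2 ^+ k.+1.
    rewrite exprS; field.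
    by rewrite expf_neq0 ?pnatr_eq0//; apply/eqP; lra.
  have w'0 : 0 <= w / 2 ^+ k.+1 by rewrite divr_ge0// exprn_ge0.
  have h'0 : 0 <= h / 2 ^+ k.+1 by rewrite divr_ge0// exprn_ge0.
  rewrite !half.
  have [g1|b1] := pselect (good k.+1 a c); last by exists (a, c); split => //=; lra.
  have [g2|b2] := pselect (good k.+1 (a + w / 2 ^+ k.+1) c);
    last by exists (a + w / 2 ^+ k.+1, c); split => //=; lra.
  have [g3|b3] := pselect (good k.+1 a (c + h / 2 ^+ k.+1));
    last by exists (a, c + h / 2 ^+ k.+1); split => //=; lra.
  have [g4|b4] := pselect (good k.+1 (a + w / 2 ^+ k.+1) (c + h / 2 ^+ k.+1));
    last by exists (a + w / 2 ^+ k.+1, c + h / 2 ^+ k.+1); split => //=; lra.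
  exists (a, c); split => /=; try lra.
  by move=> []; exact: good_quarters.
have {step}[next nextP] := choice step.
pose fix s (k : nat) : R * R := if k is j.+1 then next (j, s j) else (a0, c0).
have sbad k : ~ good k (s k).1 (s k).2.
  elim: k => [//|k IH] /=.
  by have [_ _ _ _] := nextP (k, s k); apply.
have s1 j k : (s j).1 <= (s (j + k)%N).1 /\
    (s (j + k)%N).1 + w / 2 ^+ (j + k) <= (s j).1 + w / 2 ^+ j.
  elim: k => [|k [IH1 IH2]]; first by rewrite addn0.
  rewrite addnS /=.
  by have [/= + + _ _ _] := nextP ((j + k)%N, s (j + k)%N); split; lra.
have s2 j k : (s j).2 <= (s (j + k)%N).2 /\
    (s (j + k)%N).2 + h / 2 ^+ (j + k) <= (s j).2 + h / 2 ^+ j.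
  elim: k => [|k [IH1 IH2]]; first by rewrite addn0.
  rewrite addnS /=.
  by have [/= _ _ + + _] := nextP ((j + k)%N, s (j + k)%N); split; lra.
have limit (u : nat -> R) (l : R) : 0 <= l ->
    (forall j k, u j <= u (j + k)%N /\
       u (j + k)%N + l / 2 ^+ (j + k) <= u j + l / 2 ^+ j) ->
    exists x, forall k, u k <= x <= u k + l / 2 ^+ k.
  move=> l0 uP.
  (* Every left end is at most every right end, hence the supremum of the left ends lies in all the
     intervals. *)
  have uu j k : u j <= u k + l / 2 ^+ k.
    have [jk|kj] := leqP j k.
      have [+ _] := uP j (k - j)%N; rewrite subnKC// => H.
      by rewrite (le_trans H)// lerDl divr_ge0// exprn_ge0.
    have [_ +] := uP k (j - k)%N; rewrite subnKC; last exact: ltnW.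
    apply: le_trans.
    by rewrite lerDl divr_ge0// exprn_ge0.
  exists (sup (range u)) => k; apply/andP; split.
    apply: ub_le_sup; last by exists k.
    by exists (u 0%N + l / 2 ^+ 0) => _ [j _ <-]; exact: uu.
  by apply: ge_sup; [exists (u 0%N), 0%N|move=> _ [j _ <-]; exact: uu].
have [x xP] := limit _ _ w_ge0 s1; have [y yP] := limit _ _ h_ge0 s2.
have [||e e0 eP] := @good_local x y.
- by have := xP 0%N; rewrite expr0 divr1.
- by have := yP 0%N; rewrite expr0 divr1.
have [k] : exists k : nat, w / 2 ^+ k < e /\ h / 2 ^+ k < e.
  exists (Num.bound ((w + h) / e)).
  set k := Num.bound _.
  have kP : (w + h) / e < 2 ^+ k.
    apply: lt_le_trans (archi_boundP _) _; first by rewrite divr_ge0 ?addr_ge0 ?(ltW e0).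
    by rewrite -natrX ler_nat ltnW// ltn_expl.
  rewrite !ltr_pdivrMr ?exprn_gt0//.
  rewrite ltr_pdivrMr// in kP.
  rewrite ![e * _]mulrC; split; apply: le_lt_trans kP.
    by rewrite lerDl.
  by rewrite lerDr.
by move=> [we he]; exact: (sbad k (eP _ _ _ (xP k) (yP k) we he)).
Qed.

End bisection.

Lemma continuous_of_lipschitz_at (R : realType) (f : R -> R) (x K : R) : 0 <= K ->
  (exists2 k : R, 0 < k &
     forall x', `|x' - x| < k -> `|f x' - f x| <= K * `|x' - x|) ->
  {for x, continuous f}.
Proof.
move=> K0 [k k0 kP]; apply/cvgrPdist_le => e e0.
apply/nbhs_ballP; exists (Num.min k (e / (K + 1))) => /=.
  by rewrite lt_min k0 divr_gt0// ltr_wpDl.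
move=> x'; rewrite /ball/= distrC lt_min => /andP[/kP x'k x'e].
rewrite distrC (le_trans x'k)//.
rewrite ltr_pdivlMr ?ltr_wpDl// in x'e.
by apply: le_trans (ltW x'e); rewrite mulrC ler_wpM2l// lerDl.
Qed.

Section divergence_free.
Variables (R : realType) (P Q : R -> R -> R).

(** Total differentiability of the field (P, Q) at a single point, as in Goursat's theorem, with P_x
    = A and Q_y = - A. *)
Definition divergence_free_at (x y : R) := exists A B C : R, forall e : R,
  0 < e -> exists2 k : R, 0 < k & forall x' y' : R,
    `|x' - x| < k -> `|y' - y| < k ->
    `|P x' y' - P x y - A * (x' - x) - B * (y' - y)|
      <= e * (`|x' - x| + `|y' - y|) /\
    `|Q x' y' - Q x y - C * (x' - x) + A * (y' - y)|
      <= e * (`|x' - x| + `|y' - y|).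

Lemma divergence_free_continuous x y : divergence_free_at x y ->
  {for y, continuous (P x)} /\ {for x, continuous (fun t => Q t y)}.
Proof.
move=> [A [B [C /(_ 1 ltr01)[k k0 kP]]]]; split.
- apply: (@continuous_of_lipschitz_at _ _ _ (1 + `|B|)); first by rewrite addr_ge0.
  exists k => // y' yk; have [|+ _] := kP x y' _ yk; first by rewrite subrr normr0.
  rewrite subrr normr0 mulr0 subr0 add0r => H.
  rewrite -[X in `|X|](subrK (B * (y' - y))) (le_trans (ler_normD _ _))//.
  by rewrite mulrDl lerD// normrM.
- apply: (@continuous_of_lipschitz_at _ _ _ (1 + `|C|)); first by rewrite addr_ge0.
  exists k => // x' xk; have [|_] := kP x' y xk _; first by rewrite subrr normr0.
  rewrite subrr normr0 mulr0 !addr0 => H.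
  rewrite -[X in `|X|](subrK (C * (x' - x))) (le_trans (ler_normD _ _))//.
  by rewrite mulrDl lerD// normrM.
Qed.

Variables (U V : R -> R -> R) (a b c d : R).
Hypotheses (ab : a <= b) (cd : c <= d).
Hypothesis PQ_free : forall x y, a <= x <= b -> c <= y <= d ->
  divergence_free_at x y.
Hypothesis dU : forall x y, a <= x <= b -> c <= y <= d ->
  is_derive y 1 (U x) (P x y).
Hypothesis dV : forall x y, a <= x <= b -> c <= y <= d ->
  is_derive x 1 (fun t => V t y) (Q x y).

(** With primitives U of P in y and V of Q in x, this is the outward flux of (P, Q) through the
    boundary of [a, b] x [c, d]; the free constants of the primitives cancel. *)
Definition flux (a b c d : R) :=
  U b d - U b c - U a d + U a c + (V b d - V a d - V b c + V a c).

(** The affine part of the field has zero divergence, hence zero flux. The remainder is at most e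
    times the size of the rectangle and is integrated over sides of that size, which gives a
    quadratic bound. *)
Lemma flux_le (a' b' c' d' x y A B C k e : R) :
  a <= a' -> a' <= x <= b' -> b' <= b -> c <= c' -> c' <= y <= d' -> d' <= d ->
  b' - a' < k -> d' - c' < k ->
  (forall x' y' : R, `|x' - x| < k -> `|y' - y| < k ->
    `|P x' y' - P x y - A * (x' - x) - B * (y' - y)|
      <= e * (`|x' - x| + `|y' - y|) /\
    `|Q x' y' - Q x y - C * (x' - x) + A * (y' - y)|
      <= e * (`|x' - x| + `|y' - y|)) -> 0 < e ->
  `|flux a' b' c' d'| <= 2 * e * ((b' - a') + (d' - c')) ^+ 2.
Proof.
move=> aa' /andP[a'x xb'] b'b cc' /andP[c'y yd'] d'd wk hk PQe e0.
set L := (b' - a') + (d' - c').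
have near_x x' : a' <= x' <= b' -> `|x' - x| <= b' - a'.
  by move=> ?; rewrite ler_distlC; lra.
have near_y y' : c' <= y' <= d' -> `|y' - y| <= d' - c'.
  by move=> ?; rewrite ler_distlC; lra.
have PQeL x' y' : a' <= x' <= b' -> c' <= y' <= d' ->
    `|P x' y' - P x y - A * (x' - x) - B * (y' - y)| <= e * L /\
    `|Q x' y' - Q x y - C * (x' - x) + A * (y' - y)| <= e * L.
  move=> /near_x x'P /near_y y'P.
  have [P1 Q1] := PQe _ _ (le_lt_trans x'P wk) (le_lt_trans y'P hk).
  by split; [apply: le_trans P1 _|apply: le_trans Q1 _]; rewrite ler_pM2l// lerD.
(* The terms in A are split off from both pairs of sides; their contributions to [G d' - G c'] and
   [H b' - H a'] are opposite. *)
pose G t := U b' t - U a' t - A * (b' - a') * t.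
pose H t := V t d' - V t c' + A * (d' - c') * t.
have dG : `|G d' - G c'| <= 2 * (e * L) * (d' - c').
  apply: (@derive_dist_le _ _ (fun t => P b' t - P a' t - A * (b' - a'))) => [|t tP|t tP].
  - by lra.
  - have h1 : is_derive t 1 (U b') (P b' t) by apply: dU; lra.
    have h2 : is_derive t 1 (U a') (P a' t) by apply: dU; lra.
    have h3 : is_derive t 1 (fun t => A * (b' - a') * t) (A * (b' - a')).
      by apply: is_derive_eq; rewrite /GRing.scale/= mulr1.
    exact: is_deriveB.
  - have [P1 _] := PQeL b' t (ltac:(lra)) tP.
    have [P2 _] := PQeL a' t (ltac:(lra)) tP.
    move: P1 P2; rewrite !ler_norml; lra.
have dH : `|H b' - H a'| <= 2 * (e * L) * (b' - a').
  apply: (@derive_dist_le _ _ (fun t => Q t d' - Q t c' + A * (d' - c'))) => [|t tP|t tP].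
  - by lra.
  - have h1 : is_derive t 1 (fun t => V t d') (Q t d') by apply: dV; lra.
    have h2 : is_derive t 1 (fun t => V t c') (Q t c') by apply: dV; lra.
    have h3 : is_derive t 1 (fun t => A * (d' - c') * t) (A * (d' - c')).
      by apply: is_derive_eq; rewrite /GRing.scale/= mulr1.
    exact: is_deriveD.
  - have [_ P1] := PQeL t d' tP (ltac:(lra)).
    have [_ P2] := PQeL t c' tP (ltac:(lra)).
    move: P1 P2; rewrite !ler_norml; lra.
have -> : flux a' b' c' d' = (G d' - G c') + (H b' - H a').
  by rewrite /flux /G /H; ring.
rewrite (le_trans (ler_normD _ _))// (le_trans (lerD dG dH))//.
by rewrite /L; lra.
Qed.

(** Goursat's argument: the bound e / 4^k passes from four quarters to their union, because flux is
    additive, and it holds for small rectangles about any point by [flux_le]. *)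
Lemma flux_eq0 : flux a b c d = 0.
Proof.
apply/eqP; rewrite -normr_le0; apply/ler_addgt0Pr => e e0; rewrite add0r.
set w := b - a; set h := d - c.
have w0 : 0 <= w by rewrite subr_ge0.
have h0 : 0 <= h by rewrite subr_ge0.
pose good k a' c' := a <= a' -> a' + w / 2 ^+ k <= b -> c <= c' ->
  c' + h / 2 ^+ k <= d ->
  `|flux a' (a' + w / 2 ^+ k) c' (c' + h / 2 ^+ k)| <= e / 4 ^+ k.
suff : good 0%N a c.
  rewrite /good !expr0 !divr1 /w /h ![_ + (_ - _)]addrC !subrK.
  by apply.
apply: (good_bisection w0 h0 (good := good)) => [k a' c' w' h' g1 g2 g3 g4|x y xP yP].
  have dbl (l : R) : l / 2 ^+ k = l / 2 ^+ k.+1 + l / 2 ^+ k.+1.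
    by rewrite exprS; field; rewrite expf_neq0 ?pnatr_eq0//; apply/eqP; lra.
  have quad : e / 4 ^+ k = e / 4 ^+ k.+1 + e / 4 ^+ k.+1 + e / 4 ^+ k.+1 + e / 4 ^+ k.+1.
    by rewrite exprS; field; rewrite expf_neq0 ?pnatr_eq0//; apply/eqP; lra.
  have w'0 : 0 <= w' by rewrite divr_ge0// exprn_ge0.
  have h'0 : 0 <= h' by rewrite divr_ge0// exprn_ge0.
  rewrite /good !dbl quad -/w' -/h' => aa' b'b cc' d'd.
  move: g1 g2 g3 g4; rewrite /good -/w' -/h' => g1 g2 g3 g4.
  have {}g1 := g1 (ltac:(lra)) (ltac:(lra)) (ltac:(lra)) (ltac:(lra)).
  have {}g2 := g2 (ltac:(lra)) (ltac:(lra)) (ltac:(lra)) (ltac:(lra)).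
  have {}g3 := g3 (ltac:(lra)) (ltac:(lra)) (ltac:(lra)) (ltac:(lra)).
  have {}g4 := g4 (ltac:(lra)) (ltac:(lra)) (ltac:(lra)) (ltac:(lra)).
  set F1 := flux _ _ _ _ in g1; set F2 := flux _ _ _ _ in g2.
  set F3 := flux _ _ _ _ in g3; set F4 := flux _ _ _ _ in g4.
  rewrite !addrA; rewrite (_ : flux _ _ _ _ = F1 + F2 + F3 + F4); last first.
    by rewrite /F1 /F2 /F3 /F4 /flux; ring.
  rewrite (le_trans (ler_normD _ _))// lerD//.
  rewrite (le_trans (ler_normD _ _))// lerD//.
  by rewrite (le_trans (ler_normD _ _))// lerD.
have wP : a + w = b by rewrite /w addrC subrK.
have hP : c + h = d by rewrite /h addrC subrK.
rewrite wP in xP; rewrite hP in yP.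
(* At level j, [flux_le] multiplies this tolerance by 2 (w + h)^2 / 4^j; the added 1 keeps the
   denominator positive when w + h = 0. *)
have [A [B [C /(_ (e / (2 * ((w + h) ^+ 2 + 1))))[]]]] := PQ_free xP yP.
  by rewrite divr_gt0// mulr_gt0// ltr_wpDl// sqr_ge0.
move=> k k0 kP; exists k => // j a' c' a'P c'P wk hk aa' b'b cc' d'd.
have dw : a' + w / 2 ^+ j - a' = w / 2 ^+ j by rewrite addrC addKr.
have dh : c' + h / 2 ^+ j - c' = h / 2 ^+ j by rewrite addrC addKr.
have := flux_le (a' := a') (c' := c') aa' a'P b'b cc' c'P d'd _ _ kP _.
rewrite dw dh => /(_ wk hk); rewrite divr_gt0//; last first.
  by rewrite mulr_gt0// ltr_wpDl// sqr_ge0.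
move=> /(_ isT)/le_trans; apply.
rewrite -mulrDl expr_div_n -exprM mulnC exprM (_ : 2 ^+ 2 = 4 :> R); last by ring.
rewrite mulrA ler_wpM2r ?invr_ge0 ?exprn_ge0//.
set q := (w + h) ^+ 2.
have q0 : 0 <= q by rewrite sqr_ge0.
have q1 : 0 < q + 1 by rewrite ltr_wpDl.
rewrite (_ : 2 * (e / (2 * (q + 1))) * q = e * (q / (q + 1))).
  by rewrite ler_piMr ?(ltW e0)// ler_pdivrMr// mul1r lerDl.
by field; lra.
Qed.

End divergence_free.

(** The horizontal sides cancel, so P has the same mean on x = a and on x = b, at least M and at
    most m. The margin r makes the primitives differentiable up to the ends of the sides. *)
Lemma divergence_free_strip (R : realType) (P Q : R -> R -> R)
    (a b c d r m M : R) : a <= b -> c < d -> 0 < r ->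
  (forall x y, a - r <= x <= b + r -> c - r <= y <= d + r ->
     divergence_free_at P Q x y) ->
  (forall x, a <= x <= b -> Q x c = Q x d) ->
  (forall y, c <= y <= d -> P b y <= m) ->
  (forall y, c <= y <= d -> M <= P a y) -> M <= m.
Proof.
move=> ab cd r0 PQ Qcd Pbm PaM.
have [U dU] : exists U : R -> R -> R, forall x, a <= x <= b ->
    forall y, c - r < y < d + r -> is_derive y 1 (U x) (P x y).
  suff H : forall x, exists F : R -> R, a <= x <= b ->
      forall y, c - r < y < d + r -> is_derive y 1 F (P x y).
    by have [U UP] := choice H; exists U.
  move=> x; have [xab|nxab] := pselect (a <= x <= b); last by exists (P x) => /nxab.
  have [|F FP] := @is_derive_locally_exists R (P x) (c - r) (d + r).
    by move=> y ycd; have [] := divergence_free_continuous (PQ x y (ltac:(lra)) ycd).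
  by exists F.
have [V dV] : exists V : R -> R -> R, forall y, c <= y <= d ->
    forall x, a - r < x < b + r -> is_derive x 1 (V y) (Q x y).
  suff H : forall y, exists F : R -> R, c <= y <= d ->
      forall x, a - r < x < b + r -> is_derive x 1 F (Q x y).
    by have [V VP] := choice H; exists V.
  move=> y; have [ycd|nycd] := pselect (c <= y <= d); last by exists (P y) => /nycd.
  have [|F FP] := @is_derive_locally_exists R (Q^~ y) (a - r) (b + r).
    by move=> x xab; have [] := divergence_free_continuous (PQ x y xab (ltac:(lra))).
  by exists F.
have fl0 : flux U (fun x y => V y x) a b c d = 0.
  apply: (@flux_eq0 R P Q _ _ _ _ _ _ ab (ltW cd)) => x y xab ycd.
  - by apply: PQ; lra.
  - by apply: dU; lra.
  - by apply: (dV y ycd); lra.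
have Vcd : `|(V d b - V c b) - (V d a - V c a)| <= 0 * (b - a).
  apply: (@derive_dist_le _ (fun x => V d x - V c x) (fun x => Q x d - Q x c)) => // x xab.
  - have h1 : is_derive x 1 (V d) (Q x d) by apply: dV; lra.
    have h2 : is_derive x 1 (V c) (Q x c) by apply: dV; lra.
    exact: is_deriveB.
  - by rewrite Qcd// subrr normr0.
rewrite mul0r normr_le0 subr_eq0 in Vcd; move/eqP: Vcd => Vcd.
have Ub_Ua : U b d - U b c = U a d - U a c.
  by move: fl0; rewrite /flux; lra.
have ale (f df : R -> R) (k : R) : (forall y, c <= y <= d -> is_derive y 1 f (df y)) ->
    (forall y, c <= y <= d -> df y <= k) -> f d - f c <= k * (d - c).
  move=> fdf dfk.
  have [y||y] := MVT_segment (ltW cd) (f := f) (df := df).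
  - by rewrite in_itv/= => /andP[cy yd]; apply: fdf; rewrite !ltW.
  - apply: continuous_in_subspaceT => y; rewrite inE/= in_itv/= => /fdf fy.
    exact/differentiable_continuous/derivable1_diffP.
  - by rewrite in_itv/= => /dfk dfy ->; rewrite ler_wpM2r// subr_ge0 ltW.
have Ub : U b d - U b c <= m * (d - c).
  by apply: ale Pbm => y ycd; apply: dU; lra.
have Ua : - U a d - - U a c <= - M * (d - c).
  apply: (ale (fun t => - U a t) (fun t => - P a t)) => y ycd.
    have h1 : is_derive y 1 (U a) (P a y) by apply: dU; lra.
    exact: is_deriveN.
  by rewrite lerN2 PaM.
rewrite -(@ler_pM2r _ (d - c)) ?subr_gt0//.
by move: Ub Ua; lra.
Qed.

(** * The mean value property on circles *)

Lemma is_derive_eps (R : realType) (f : R -> R) (x l : R) : is_derive x 1 f l ->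
  forall e : R, 0 < e -> exists2 k : R, 0 < k & forall h, `|h| < k ->
    `|f (x + h) - f x - l * h| <= e * `|h|.
Proof.
move=> [df fl] e e0; move: df.
rewrite /derivable => /cvg_ex[l' fl']; have ll' : l' = l.
  by rewrite -fl /derive; apply/esym/cvg_lim.
rewrite {}ll' in fl'.
move/cvgrPdist_le : fl' => /(_ e e0) /=.
rewrite /dnbhs => /nbhs_ballP[k /= k0 kP]; exists k => // h hk.
have [->|h0] := eqVneq h 0; first by rewrite addr0 subrr mulr0 subrr normr0 mulr0.
have := kP h; rewrite /ball/= sub0r normrN => /(_ hk h0).
rewrite /GRing.scale/= mulr1 [h + x]addrC => H.
rewrite -ler_pdivrMr ?normr_gt0// -normrV ?unitfE// -normrM.
rewrite distrC in H; apply: le_trans H.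
by rewrite le_eqVlt; apply/orP; left; apply/eqP; congr (`|_|); field.
Qed.


Section complex_norm.
Variable R : realType.
Implicit Types z : R[i].

Lemma Re_le_normc z : `|Re z| <= normc z.
Proof.
case: z => x y /=; rewrite -sqrtr_sqr ler_sqrt ?addr_ge0 ?sqr_ge0//.
by rewrite lerDl sqr_ge0.
Qed.

Lemma Im_le_normc z : `|Im z| <= normc z.
Proof.
case: z => x y /=; rewrite -sqrtr_sqr ler_sqrt ?addr_ge0 ?sqr_ge0//.
by rewrite lerDr sqr_ge0.
Qed.

Lemma normc_le_ReIm z : normc z <= `|Re z| + `|Im z|.
Proof.
case: z => x y /=.
rewrite -(ger0_norm (addr_ge0 (normr_ge0 x) (normr_ge0 y))) -sqrtr_sqr.
rewrite ler_sqrt ?sqr_ge0// sqrrD !real_normK ?num_real//.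
by have := mulr_ge0 (normr_ge0 x) (normr_ge0 y); lra.
Qed.

Lemma normc_ge0 z : 0 <= normc z.
Proof. by case: z => x y /=; exact: sqrtr_ge0. Qed.

End complex_norm.

Lemma differentiable_eps (R : realType) (f : R[i] -> R[i]) (z : R[i]) :
  differentiable f z ->
  exists A : R[i], forall e : R, 0 < e -> exists2 k : R, 0 < k & forall h,
    normc h < k -> normc (f (z + h) - f z - A * h) <= e * normc h.
Proof.
move=> /derivable1_diffP; rewrite /derivable => /cvg_ex[A fA].
exists A => e e0.
have eC : 0 < (e%:C)%C by rewrite ltcR.
move/cvgrPdist_le : fA => /(_ _ eC); rewrite /dnbhs => /nbhs_ballP[[k k'] /=].
(* Positive elements of [R[i]] are real, which turns the radius into a real number. *)
rewrite ltcE /= => /andP[/eqP-> k0] kP; exists k => // h hk.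
have [->|h0] := eqVneq h 0; first by rewrite addr0 subrr mulr0 subrr normc0 mulr0.
have := kP h; rewrite /ball/= sub0r normrN ltcR => /(_ hk h0).
rewrite /GRing.scale/= mulr1 [h + z]addrC distrC lecR => H.
have hE : f (z + h) - f z - A * h = (h^-1 * (f (z + h) - f z) - A) * h by field.
by rewrite hE normcM ler_wpM2r// normc_ge0.
Qed.

Section cexp.
Variable R : realType.

Definition cexp (x y : R) : R[i] := ((expR x * cos y) +i* (expR x * sin y))%C.

Lemma cexpD x y h t : cexp (x + h) (y + t) = cexp x y * cexp h t.
Proof.
rewrite /cexp expRD cosD sinD; apply/eqP; rewrite eq_complex /=.
by apply/andP; split; apply/eqP; ring.
Qed.

Lemma normc_cexp x y : normc (cexp x y) = expR x.
Proof.
rewrite /cexp /= !exprMn -mulrDr cos2Dsin2 mulr1 sqrtr_sqr.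
by rewrite ger0_norm ?expR_ge0.
Qed.

Lemma cexp_2pi x : cexp x (pi *+ 2) = cexp x 0.
Proof. by rewrite /cexp cos2pi sin2pi cos0 sin0. Qed.

(** The exponential has complex derivative 1 at 0; this is assembled from the derivatives of the
    real exponential, cosine and sine. *)
Lemma cexp_eps (e : R) : 0 < e -> exists2 k : R, 0 < k & forall h t,
  `|h| < k -> `|t| < k ->
  normc (cexp h t - 1 - (h +i* t)%C) <= e * (`|h| + `|t|).
Proof.
(* The errors below add up to at most e' |h| + 7 e' |t|, hence the factor 8; e' <= 1 serves to bound
   |1 + h| by 2 and |sin t| by 2 |t|. *)
move=> e0; have [e' [e'0 e'1 e'e]] : exists e' : R, [/\ 0 < e', e' <= 1 & 8 * e' <= e].
  exists (Num.min 1 (e / 8)); split; first by rewrite lt_min ltr01 divr_gt0.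
    by rewrite ge_min lexx.
  by rewrite mulrC -ler_pdivlMr// ge_min lexx orbT.
have [k1 k10 k1P] := is_derive_eps (is_derive_expR 0) e'0.
have [k2 k20 k2P] := is_derive_eps (is_derive_cos 0) e'0.
have [k3 k30 k3P] := is_derive_eps (is_derive_sin 0) e'0.
exists (Num.min (Num.min k1 k2) (Num.min k3 e')).
  by rewrite !(lt_min 0) k10 k20 k30 e'0.
move=> h t; rewrite !lt_min => /andP[/andP[hk1 hk2] /andP[hk3 he]].
move=> /andP[/andP[tk1 tk2] /andP[tk3 te]].
have := k1P _ hk1; rewrite add0r expR0 mul1r => H1.
have := k2P _ tk2; rewrite add0r cos0 sin0 oppr0 mul0r subr0 => H2.
have := k3P _ tk3; rewrite add0r sin0 cos0 subr0 mul1r => H3.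
apply: le_trans (normc_le_ReIm _) _; rewrite /cexp /=.
have h0 := normr_ge0 h; have t0 := normr_ge0 t.
have cos1 : `|cos t| <= 1 by exact: cos_max.
have R1 : `|expR h * cos t - 1 - h| <= e' * `|h| + 2 * (e' * `|t|).
  rewrite (_ : _ - h = (expR h - 1 - h) * cos t + (1 + h) * (cos t - 1)); last by ring.
  apply: le_trans (ler_normD _ _) _; rewrite !normrM lerD//.
    by rewrite -[leRHS]mulr1 ler_pM.
  apply: ler_pM => //; apply: le_trans (ler_normD _ _) _; rewrite normr1.
  by lra.
have R2 : `|expR h * sin t - 0 - t| <= 4 * (e' * `|t|) + e' * `|t|.
  rewrite subr0 (_ : _ - t = (expR h - 1) * sin t + (sin t - t)); last by ring.
  apply: le_trans (ler_normD _ _) _; rewrite lerD// normrM.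
  rewrite (_ : 4 * (e' * `|t|) = (2 * e') * (2 * `|t|)); last by ring.
  have A1 : `|expR h - 1| <= 2 * e'.
    rewrite -[X in `|X|](subrK h); apply: le_trans (ler_normD _ _) _.
    by nra.
  have A2 : `|sin t| <= 2 * `|t|.
    rewrite -[X in `|X|](subrK t); apply: le_trans (ler_normD _ _) _.
    by nra.
  by apply: ler_pM.
apply: le_trans (lerD R1 R2) _.
by nra.
Qed.

End cexp.

Lemma normcD (R : realType) (x y : R[i]) : normc (x + y) <= normc x + normc y.
Proof. exact: le_normcD. Qed.

Lemma normcBC (R : realType) (x y : R[i]) : normc (x - y) = normc (y - x).
Proof. by rewrite -[in LHS]opprB; exact: normcN. Qed.

(** By the chain rule the composite has complex derivative B = A exp(x + iy) in x + iy; the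
    Cauchy-Riemann equations then give the divergence Re B - Re B = 0. *)
Lemma polar_divergence_free (R : realType) (q : R[i] -> R[i]) (c : R[i]) (x y : R) :
  differentiable q (c + cexp x y) ->
  divergence_free_at (fun x y => Re (q (c + cexp x y)))
    (fun x y => - Im (q (c + cexp x y))) x y.
Proof.
move=> /differentiable_eps[A AP].
set z := c + cexp x y in AP *; set E := expR x.
have E0 : 0 < E by exact: expR_gt0.
set B := A * cexp x y.
exists (Re B), (- Im B), (- Im B) => e e0.
(* Since |zeta| <= 2 E L below, this tolerance costs e / 2 times L; the other half is spent on the
   exponential through [e2]. *)
have [|k1 k10 k1P] := AP (e / (4 * E)); first by rewrite divr_gt0// mulr_gt0.
have nA0 : 0 <= normc A by exact: normc_ge0.
have AE0 : 0 <= normc A * E by rewrite mulr_ge0// ltW.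
have [e2 [e20 e21 e2e]] : exists e2 : R, [/\ 0 < e2, e2 <= 1 & normc A * E * e2 <= e / 2].
  exists (Num.min 1 (e / 2 / (normc A * E + 1))); split.
  - by rewrite lt_min ltr01 !divr_gt0// ltr_wpDl.
  - by rewrite ge_min lexx.
  - apply: (@le_trans _ _ (normc A * E * (e / 2 / (normc A * E + 1)))).
      by rewrite ler_wpM2l// ge_min lexx orbT.
    rewrite mulrA ler_pdivrMr ?ltr_wpDl// mulrC ler_wpM2l ?divr_ge0 ?(ltW e0)//.
    by rewrite lerDl.
have [k2 k20 k2P] := cexp_eps e20.
exists (Num.min k2 (k1 / (4 * E))).
  by rewrite lt_min k20 divr_gt0// mulr_gt0.
move=> x' y'; rewrite !lt_min => /andP[hk2 hk1] /andP[tk2 tk1].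
set h := x' - x in hk1 hk2 *; set t := y' - y in tk1 tk2 *.
have -> : x' = x + h by rewrite /h addrC subrK.
have -> : y' = y + t by rewrite /t addrC subrK.
set L := `|h| + `|t|.
have L0 : 0 <= L by rewrite addr_ge0.
have hP := k2P _ _ hk2 tk2; rewrite -/L in hP.
set zeta := cexp x y * (cexp h t - 1).
have zE : c + cexp (x + h) (y + t) = z + zeta.
  by rewrite cexpD /z /zeta; ring.
have nL : normc (h +i* t)%C <= L by exact: normc_le_ReIm.
have nz : normc zeta <= 2 * E * L.
  rewrite normcM normc_cexp -/E (_ : 2 * E * L = E * (2 * L)); last by ring.
  rewrite ler_pM2l//.
  rewrite -(subrK (h +i* t)%C (cexp h t - 1)).
  apply: le_trans (normcD _ _) _; nra.
have nzk : normc zeta < k1.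
  apply: le_lt_trans nz _; rewrite /L.
  by move: hk1 tk1; rewrite !ltr_pdivlMr ?mulr_gt0//; lra.
have key : normc (q (z + zeta) - q z - B * (h +i* t)%C) <= e * L.
  rewrite (_ : _ - _ = (q (z + zeta) - q z - A * zeta) +
     A * cexp x y * (cexp h t - 1 - (h +i* t)%C)); last first.
    by rewrite /B /zeta; ring.
  apply: le_trans (normcD _ _) _.
  rewrite (_ : e * L = e / 2 * L + e / 2 * L); last by field.
  apply: lerD.
    apply: le_trans (k1P _ nzk) _.
    rewrite (_ : e / 2 * L = e / (4 * E) * (2 * E * L)).
      by rewrite ler_pM2l// divr_gt0// mulr_gt0.
    by field; lra.
  rewrite !normcM normc_cexp -/E.
  apply: (@le_trans _ _ (normc A * E * (e2 * L))); first by rewrite ler_wpM2l.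
  by rewrite mulrA ler_wpM2r.
rewrite zE; split; apply: le_trans key.
  apply: le_trans (Re_le_normc _); rewrite le_eqVlt; apply/orP; left; apply/eqP.
  congr (`|_|); case: (q (z + zeta)) (q z) B => ? ? [? ?] [? ?] /=; ring.
apply: le_trans (Im_le_normc _); rewrite -normrN le_eqVlt; apply/orP; left; apply/eqP.
congr (`|_|); case: (q (z + zeta)) (q z) B => ? ? [? ?] [? ?] /=; ring.
Qed.

Lemma continuous_epsP (R : realType) (q : R[i] -> R[i]) (c : R[i]) :
  {for c, continuous q} <-> forall e : R, 0 < e -> exists2 k : R, 0 < k &
    forall z, normc (z - c) < k -> normc (q z - q c) < e.
Proof.
split=> [qc e e0|qP].
  have eC : 0 < (e%:C)%C by rewrite ltcR.
  move/cvgrPdist_lt : qc => /(_ _ eC) /nbhs_ballP[[k k'] /=].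
  rewrite ltcE /= => /andP[/eqP-> k0] kP; exists k => // z zk.
  by have := kP z; rewrite /ball/= distrC ltcR => /(_ zk); rewrite distrC ltcR.
apply/(@cvgrPdist_lt _ R[i] _ (nbhs c)) => -[e e']; rewrite ltcE /= => /andP[/eqP-> e0].
have [k k0 kP] := qP e e0.
apply/nbhs_ballP; exists (k%:C)%C; first by rewrite /= ltcR.
by move=> z; rewrite /ball/= distrC ltcR => /kP; rewrite distrC ltcR.
Qed.

(* The logarithmic coordinates z = c + exp(x + iy) turn circles about c into
   vertical sides of rectangles, whose horizontal sides contribute equal
   fluxes by periodicity. *)
Lemma circle_not_below_center (R : realType) (q : R[i] -> R[i]) (c : R[i]) (d s eta : R) :
  {for c, continuous q} ->
  (forall z, 0 < normc (z - c) < d -> differentiable q z) ->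
  0 < s < d -> 0 < eta ->
  ~ (forall z, normc (z - c) = s -> Re (q z) <= Re (q c) - eta).
Proof.
move=> /continuous_epsP qc dq /andP[s0 sd] eta0 qs.
have [|k k0 kP] := qc (eta / 2); first by rewrite divr_gt0.
have d0 : 0 < d by exact: lt_trans sd.
have [t [t0 tk ts]] : exists t : R, [/\ 0 < t, t < k & t <= s].
  exists (Num.min (k / 2) s); split.
  - by rewrite lt_min s0 divr_gt0.
  - by rewrite gt_min ltr_pdivrMr// ltr_pMr// ltr1n.
  - by rewrite ge_min lexx orbT.
have ln_lt : ln s < ln d by rewrite ltr_ln.
suff : Re (q c) - eta / 2 <= Re (q c) - eta by lra.
(* The strip runs from x = ln t to x = ln s and over one period in y. The margin keeps exp x below
   d, and on the small circle of radius t continuity gives Re q >= Re q(c) - eta / 2. *)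
apply: (@divergence_free_strip _ (fun x y => Re (q (c + cexp x y)))
    (fun x y => - Im (q (c + cexp x y))) (ln t) (ln s) 0 (pi *+ 2) ((ln d - ln s) / 2)).
- by rewrite ler_ln.
- by rewrite mulrn_wgt0// pi_gt0.
- by lra.
- move=> x y /andP[_ xs] _; apply: polar_divergence_free; apply: dq.
  rewrite addrC addKr normc_cexp expR_gt0/= -[ltRHS]lnK ?posrE//.
  by rewrite ltr_expR; lra.
- by move=> x _; rewrite cexp_2pi.
- by move=> y _; apply: qs; rewrite addrC addKr normc_cexp lnK.
- move=> y _; have := kP (c + cexp (ln t) y).
  rewrite addrC addKr normc_cexp lnK ?posrE// => /(_ tk) /ltW H.
  have := le_trans (Re_le_normc _) H; rewrite ler_norml.
  case: (q _) (q c) => ? ? [? ?] /=; lra.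
Qed.

(** * The maximum principle *)

Lemma disc_EVT_max (R : realType) (phi : R[i] -> R) (c : R[i]) (r : R) : 0 <= r ->
  (forall z, normc (z - c) <= r -> forall e : R, 0 < e -> exists2 k : R, 0 < k &
     forall z', normc (z' - z) < k -> `|phi z' - phi z| < e) ->
  exists2 c1, normc (c1 - c) <= r &
    forall z, normc (z - c) <= r -> phi z <= phi c1.
Proof.
move=> r0 phic.
pose K : set (R * R) := [set p | p.1 ^+ 2 + p.2 ^+ 2 <= r ^+ 2].
pose g (p : R * R) := phi (c + (p.1 +i* p.2)%C).
have KP (p : R * R) : K p <-> normc (p.1 +i* p.2)%C <= r.
  rewrite /K /= -(ler_sqrt _ (sqr_ge0 r)) sqrtr_sqr ger0_norm//.
have Kc : compact K.
  apply: (@subclosed_compact _ _ (`[-r, r] `*` `[-r, r])).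
  - apply: (@preimage_closed _ _ (fun p : R * R => p.1 ^+ 2 + p.2 ^+ 2) [set x | x <= r ^+ 2]).
      move=> p _; apply: cvgD; rewrite !expr2; apply: cvgM;
        (exact: cvg_fst || exact: cvg_snd).
    exact: closed_le.
  - by apply: compact_setX; exact: segment_compact.
  - move=> p /KP pr; have := le_trans (Re_le_normc _) pr.
    have := le_trans (Im_le_normc _) pr => /=.
    by rewrite !ler_norml => ? ?; split; rewrite /= in_itv.
have [||p pK pmax] := @compact_EVT_max _ _ g K _ Kc.
- by exists (0, 0); apply/KP; rewrite /= expr0n addr0 sqrtr0.
- apply: continuous_in_subspaceT => p /set_mem /KP pr.
  apply/cvgrPdist_lt => e e0.
  have [|k k0 kP] := phic (c + (p.1 +i* p.2)%C) _ _ e0; first by rewrite addrC addKr.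
  have k20 : 0 < k / 2 by rewrite divr_gt0.
  exists (ball p.1 (k / 2), ball p.2 (k / 2)); first by split; exact: nbhsx_ballx.
  move=> p' [/= p1 p2]; rewrite distrC; apply: kP.
  rewrite opprD addrACA subrr add0r; apply: le_lt_trans (normc_le_ReIm _) _ => /=.
  move: p1 p2; rewrite /ball /= [`|p.1 - _|]distrC [`|p.2 - _|]distrC; lra.
- exists (c + (p.1 +i* p.2)%C).
    by rewrite addrC addKr; apply/KP/set_mem.
  move=> z zr; have [p' p'E] : exists p' : R * R, (p'.1 +i* p'.2)%C = z - c.
    by exists (Re (z - c), Im (z - c)) => /=; case: (z - c).
  have := pmax p'; rewrite /g p'E [c + (z - c)]addrC subrK; apply.
  by apply/mem_set/KP; rewrite p'E.
Qed.

Lemma exists_separation (R : realType) (S : seq R[i]) (c : R[i]) (d : R) : 0 < d ->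
  exists s : R, [/\ 0 < s, s <= d & forall p, p \in S -> p != c -> s <= normc (p - c)].
Proof.
move=> d0; elim: S => [|a S [s [s0 sd sS]]]; first by exists d.
have [->|ac] := eqVneq a c.
  exists s; split => // p; rewrite in_cons => /orP[/eqP->|]; last exact: sS.
  by rewrite eqxx.
have nac : 0 < normc (a - c).
  rewrite lt_def normc_ge0 andbT; apply: contra ac => /eqP/eq0_normc/eqP.
  by rewrite subr_eq0.
exists (Num.min s (normc (a - c))); split.
- by rewrite lt_min s0.
- by rewrite ge_min sd.
- move=> p; rewrite in_cons ge_min => /orP[/eqP->|pS pc]; first by rewrite lexx orbT.
  by rewrite sS.
Qed.

Lemma exists_phase (R : realType) (z : R[i]) :
  exists2 u : R[i], normc u = 1 & Re (u * z) = normc z.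
Proof.
have [->|z0] := eqVneq z 0.
  by exists 1; rewrite ?normc1// mulr0 normc0.
case: z z0 => x y xy0; set m := normc (x +i* y)%C.
have m0 : m != 0 by apply: contra xy0 => /eqP/eq0_normc/eqP.
have mE : m ^+ 2 = x ^+ 2 + y ^+ 2.
  by rewrite sqr_sqrtr// addr_ge0 ?sqr_ge0.
exists ((x / m) +i* (- (y / m)))%C => /=.
  rewrite sqrrN !expr_div_n -mulrDl -mE divff ?sqrtr1//.
  by rewrite expf_neq0.
rewrite -[RHS](mulfK m0) -expr2 mE.
by field.
Qed.

Lemma normc_sqrD (R : realType) (x y : R[i]) :
  normc (x + y) ^+ 2 = normc x ^+ 2 + normc y ^+ 2 + 2 * Re (x^*%C * y).
Proof.
by case: x y => a b [a' b'] /=; rewrite !sqr_sqrtr ?addr_ge0 ?sqr_ge0//; ring.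
Qed.

Lemma normc_dist (R : realType) (x y : R[i]) : `|normc x - normc y| <= normc (x - y).
Proof.
have := normcD (x - y) y; rewrite subrK; have := normcD (y - x) x; rewrite subrK.
by rewrite [normc (y - x)]normcBC ler_distlC; lra.
Qed.

Lemma ReD (R : realType) (x y : R[i]) : Re (x + y) = Re x + Re y.
Proof. by case: x y => ? ? []. Qed.

Lemma ReZ (R : realType) (a : R) (x : R[i]) : Re (a%:C%C * x) = a * Re x.
Proof. by case: x => x y /=; rewrite mul0r subr0. Qed.

Lemma normc_sqr_eps (R : realType) (z : R[i]) (e : R) : 0 < e ->
  exists2 k : R, 0 < k &
    forall z', normc (z' - z) < k -> `|normc z' ^+ 2 - normc z ^+ 2| < e.
Proof.
move=> e0; pose B := normc z; have B0 : 0 <= B by exact: normc_ge0.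
have B1 : 0 < 2 * B + 1 by lra.
exists (Num.min 1 (e / (2 * B + 1))); first by rewrite lt_min ltr01 divr_gt0.
move=> z'; rewrite lt_min -/B ltr_pdivlMr// => /andP[t1 te].
have := normc_dist z' z; rewrite -/B => AB.
have A0 : 0 <= normc z' by exact: normc_ge0.
rewrite subr_sqr normrM [X in _ * X]ger0_norm ?addr_ge0//.
apply: le_lt_trans te; apply: ler_pM => //; first by rewrite addr_ge0.
by move: AB; rewrite ler_norml; lra.
Qed.

Lemma differentiable_affine (R : realType) (a b z : R[i]) :
  differentiable (fun z : R[i] => a * (z - b) : R[i]) z.
Proof. by []. Qed.

(* If |k| exceeded M somewhere, then |k| + e|z - c|^2 would attain its maximum
   at an interior point c1; near c1 the holomorphic function q below would then
   stay below its value at c1. *)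
Lemma max_modulus (R : realType) (k : R[i] -> R[i]) (c : R[i]) (r M : R)
    (S : seq R[i]) : 0 < r ->
  (forall z, normc (z - c) <= r -> {for z, continuous k}) ->
  (forall z, normc (z - c) < r -> z \notin S -> differentiable k z) ->
  (forall z, normc (z - c) = r -> normc (k z) <= M) ->
  forall z, normc (z - c) <= r -> normc (k z) <= M.
Proof.
move=> r0 kc dk kM z0 z0r; rewrite leNgt; apply/negP => Mz0.
(* Chosen so that |k(z0)| = M + 2 e r^2, whereas the perturbed function is at most M + e r^2 on the
   boundary circle; its maximum is therefore interior. *)
pose e := (normc (k z0) - M) / (2 * r ^+ 2).
have r20 : 0 < r ^+ 2 by rewrite exprn_gt0.
have e0 : 0 < e by rewrite divr_gt0 ?subr_gt0// mulr_gt0.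
have z0E : normc (k z0) = M + 2 * (e * r ^+ 2) by rewrite /e; field; lra.
have [|c1 c1r c1max] := @disc_EVT_max _ (fun z => normc (k z) + e * normc (z - c) ^+ 2) c r (ltW r0).
  move=> z zr a a0.
  have a20 : 0 < a / 2 by rewrite divr_gt0.
  have [k1 k10 k1P] := (continuous_epsP _ _).1 (kc z zr) _ a20.
  have [|k2 k20 k2P] := @normc_sqr_eps _ (z - c) (a / 2 / e); first by rewrite divr_gt0.
  exists (Num.min k1 k2); first by rewrite lt_min k10.
  move=> z'; rewrite lt_min => /andP[/k1P H1]; have := k2P (z' - c).
  rewrite opprB addrA subrK => /[apply] H2.
  rewrite opprD addrACA -mulrBr; apply: le_lt_trans (ler_normD _ _) _.
  rewrite (_ : a = a / 2 + a / 2); last by field.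
  apply: ltrD; first exact: le_lt_trans (normc_dist _ _) H1.
  by rewrite normrM gtr0_norm// mulrC -ltr_pdivlMr.
have c1lt : normc (c1 - c) < r.
  rewrite lt_def c1r andbT; apply/eqP => c1E.
  have := c1max _ z0r; have := kM _ (esym c1E); rewrite -c1E z0E.
  have := mulr_ge0 (ltW e0) (sqr_ge0 (normc (z0 - c))).
  have := mulr_gt0 e0 r20.
  lra.
have [|d [d0 dr dS]] := @exists_separation _ S c1 (r - normc (c1 - c)).
  by rewrite subr_gt0.
have [u u1 uk] := exists_phase (k c1).
(* The second term has real part e (|z - c|^2 - |c1 - c|^2 - |z - c1|^2), and Re (u k(c1)) =
   |k(c1)|. Maximality at c1 thus gives Re q(z) <= Re q(c1) - e |z - c1|^2. *)
pose q z := u * k z + (2 * e)%:C%C * (c1 - c)^*%C * (z - c1).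
apply: (@circle_not_below_center _ q c1 d (d / 2) (e * (d / 2) ^+ 2)).
- have h1 : {for c1, continuous (fun z => u * k z)}.
    by apply: continuousM; [exact: cst_continuous|exact: kc].
  have h2 := differentiable_continuous (differentiable_affine ((2 * e)%:C%C * (c1 - c)^*%C) c1 c1).
  exact: (continuousD h1 h2).
- move=> z /andP[z1 zd].
  have zr : normc (z - c) < r.
    rewrite -(subrK c1 z) -addrA; apply: le_lt_trans (normcD _ _) _; lra.
  have zS : z \notin S.
    apply/negP => /dS H; have : z != c1.
      by apply: contraTneq z1 => ->; rewrite subrr normc0 ltxx.
    by move=> /H; rewrite leNgt zd.
  have dkz := dk _ zr zS.
  apply: differentiableD (differentiable_affine _ _ _).
  exact: differentiableM.
- by lra.
- by rewrite mulr_gt0// exprn_gt0// divr_gt0.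
- move=> z zs.
  have zr : normc (z - c) <= r.
    rewrite -(subrK c1 z) -addrA; apply: le_trans (normcD _ _) _; lra.
  have := c1max _ zr.
  rewrite (_ : z - c = (c1 - c) + (z - c1)); last by ring.
  rewrite (normc_sqrD (c1 - c) (z - c1)) zs /q subrr mulr0 addr0 uk ReD -mulrA ReZ.
  have := le_trans (ler_norm _) (Re_le_normc (u * k z)).
  rewrite normcM u1 mul1r; lra.
Qed.

(** * Schwarz's lemma and the identity theorem *)

Section removable_quotient.
Variables (R : realType) (h : R[i] -> R[i]) (a : R[i]).

Lemma near_neq (z : R[i]) : z != a -> \forall z' \near z, z' != a.
Proof.
move=> za; apply/nbhs_ballP; exists `|z - a|; first by rewrite /= normr_gt0 subr_eq0.
by move=> z'; apply: contraTneq => ->; rewrite /ball/= ltxx.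
Qed.

(** If h(a) = 0 and A is the derivative of h at a, this is continuous at a. Continuity there is
    enough for [max_modulus], whose finite set S can take in the point a. *)
Definition patched_quotient (A : R[i]) (z : R[i]) : R[i] :=
  if z == a then A else (z - a)^-1 * h z.

Lemma patched_quotient_near A z : z != a ->
  \forall z' \near z, (z' - a)^-1 * h z' = patched_quotient A z'.
Proof.
move=> /near_neq; apply: filterS => z' z'a.
by rewrite /patched_quotient (negbTE z'a).
Qed.

Lemma differentiable_patched_quotient A z : z != a -> differentiable h z ->
  differentiable (patched_quotient A) z.
Proof.
move=> za dh; apply/derivable1_diffP.
apply: near_eq_derivable (patched_quotient_near A za) _.
apply/derivable1_diffP; apply: differentiableM dh.
by apply: differentiableV => //; rewrite subr_eq0.
Qed.

Lemma continuous_patched_quotient A z : z != a -> {for z, continuous h} ->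
  {for z, continuous (patched_quotient A)}.
Proof.
move=> za ch; rewrite /prop_for /continuous_at /patched_quotient (negbTE za).
apply: cvg_trans (near_eq_cvg (patched_quotient_near A za)) _.
have za0 : z - a != 0 by rewrite subr_eq0.
by apply: cvgM ch; apply: (cvgV za0); apply: cvgB; [exact: cvg_id|exact: cvg_cst].
Qed.

Lemma continuous_patched_quotient_center : differentiable h a -> h a = 0 ->
  exists A, {for a, continuous (patched_quotient A)}.
Proof.
move=> /differentiable_eps[A AP] ha0; exists A; apply/continuous_epsP => e e0.
have [|k k0 kP] := AP (e / 2); first by rewrite divr_gt0.
exists k => // z zk; rewrite /patched_quotient eqxx.
case: eqVneq => [_|za]; first by rewrite subrr normc0.
have za0 : z - a != 0 by rewrite subr_eq0.
have nza : 0 < normc (z - a).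
  by rewrite lt_def normc_ge0 andbT; apply: contra za0 => /eqP/eq0_normc/eqP.
have := kP _ zk; rewrite [a + _]addrC subrK ha0 subr0.
rewrite (_ : h z - _ = (z - a) * ((z - a)^-1 * h z - A)); last first.
  by field.
rewrite normcM mulrC ler_pM2r// => /le_lt_trans; apply.
by rewrite ltr_pdivrMr// ltr_pMr// ltr1n.
Qed.

End removable_quotient.

(** The maximum principle for h(z) / (z - c) on circles of radius r < d bounds the quotient by 1 /
    r; then r tends to d. *)
Lemma schwarz_bound (R : realType) (h : R[i] -> R[i]) (c : R[i]) (d : R) : 0 < d ->
  (forall z, normc (z - c) < d -> differentiable h z) ->
  (forall z, normc (z - c) < d -> normc (h z) <= 1) -> h c = 0 ->
  forall z, normc (z - c) < d -> normc (h z) <= normc (z - c) / d.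
Proof.
move=> d0 dh h1 hc z zd.
have [A Ac] : exists A, {for c, continuous (patched_quotient h c A)}.
  by apply: continuous_patched_quotient_center hc; apply: dh; rewrite subrr normc0.
have bound r : 0 < r -> r < d -> normc (z - c) <= r -> normc (h z) * r <= normc (z - c).
  move=> r0 rd zr.
  have [->|zc] := eqVneq z c; first by rewrite hc subrr normc0 mul0r.
  have : normc (patched_quotient h c A z) <= r^-1.
    apply: (@max_modulus _ _ c r _ [:: c] r0 _ _ _ z zr) => {zc zd zr}z zr.
    - have [->|zc'] := eqVneq z c; first exact: Ac.
      apply: continuous_patched_quotient zc' _.
      exact/differentiable_continuous/dh/(le_lt_trans zr).
    - rewrite mem_seq1 => zc'; apply: differentiable_patched_quotient zc' _.
      exact/dh/(lt_trans zr).
    - rewrite /patched_quotient; case: eqVneq => [zc'|zc'].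
        by move: zr r0; rewrite zc' subrr normc0 => <-; rewrite ltxx.
      rewrite normcM normcV zr ler_piMr ?invr_ge0 ?(ltW r0)// h1//.
      by rewrite zr.
  rewrite /patched_quotient (negbTE zc) normcM normcV.
  have nzc : 0 < normc (z - c).
    rewrite lt_def normc_ge0 andbT; apply: contra zc => /eqP/eq0_normc/eqP.
    by rewrite subr_eq0.
  by rewrite ler_pdivrMl// ler_pdivlMr.
rewrite ler_pdivlMr// leNgt; apply/negP => lt_h.
set m := normc (h z) in bound lt_h; set t := normc (z - c) in bound zd lt_h.
have m1 : m <= 1 by exact: h1.
have t0 : 0 <= t by exact: normc_ge0.
have m0 : 0 < m by rewrite -(pmulr_lgt0 _ d0); exact: le_lt_trans lt_h.
have tm : t / m < d by rewrite ltr_pdivrMr// mulrC.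
have ttm : t <= t / m by rewrite ler_pdivlMr// ler_piMr.
(* If m d > t, the midpoint of t / m and d is an admissible radius that violates the bound. *)
have : m * ((d + t / m) / 2) <= t by apply: bound; lra.
rewrite (_ : m * _ = (m * d + t) / 2); last by field; rewrite gt_eqF.
lra.
Qed.

(** The zeros are divided out one at a time. As they are distinct, the linear factors already split
    off do not vanish at the next zero, so the remaining factor does. *)
Lemma zeros_factor (R : realType) (h : R[i] -> R[i]) (U : set R[i]) (s : seq R[i]) :
  (forall z, U z -> differentiable h z) -> uniq s ->
  (forall a, a \in s -> U a /\ h a = 0) ->
  exists k : R[i] -> R[i],
    [/\ forall z, U z -> {for z, continuous k},
        forall z, U z -> z \notin s -> differentiable k z
      & forall z, U z -> h z = (\prod_(a <- s) (z - a)) * k z].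
Proof.
move=> dh; elim: s => [_ _|a s IH /= /andP[as_ us] zs].
  exists h; split => [z Uz|z Uz _|z Uz]; last by rewrite big_nil mul1r.
    exact/differentiable_continuous/dh.
  exact: dh.
have [|k [kc dk kE]] := IH us; first by move=> b bs; apply: zs; rewrite in_cons bs orbT.
have [Ua ha] := zs a (mem_head _ _).
have ka : k a = 0.
  have := kE a Ua; rewrite ha => /esym/eqP; rewrite mulf_eq0 => /orP[|/eqP//].
  rewrite prodf_seq_eq0 => /hasP[b bs /=]; rewrite subr_eq0 => /eqP ab.
  by rewrite ab bs in as_.
have [A Ac] := continuous_patched_quotient_center (dk a Ua as_) ka.
exists (patched_quotient k a A); split => z Uz.
- have [->|za] := eqVneq z a; first exact: Ac.
  exact: continuous_patched_quotient za (kc z Uz).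
- rewrite in_cons negb_or => /andP[za zs'].
  exact: differentiable_patched_quotient za (dk z Uz zs').
- rewrite big_cons kE// /patched_quotient; have [->|za] := eqVneq z a.
    by rewrite ka subrr !mul0r mulr0.
  by rewrite mulrACA mulrA mulfV ?mul1r// subr_eq0.
Qed.

Lemma normc_prod (R : realType) (I : Type) (s : seq I) (F : I -> R[i]) :
  normc (\prod_(i <- s) F i) = \prod_(i <- s) normc (F i).
Proof. by apply: big_morph => [x y|]; [exact: normcM|exact: normc1]. Qed.

Lemma prod_const_seq (R : pzSemiRingType) (I : Type) (s : seq I) (x : R) :
  \prod_(i <- s) x = x ^+ size s.
Proof. by elim: s => [|a s IH]; rewrite ?big_nil// big_cons IH -exprS. Qed.

Definition zeros_cluster (R : realType) (h : R[i] -> R[i]) (c : R[i]) :=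
  forall e : R, 0 < e -> exists2 z, 0 < normc (z - c) < e & h z = 0.

(** Each new zero is taken closer to [c] than all the earlier ones, hence differs from them. *)
Lemma many_zeros (R : realType) (h : R[i] -> R[i]) (c : R[i]) (N : nat) (e : R) :
  zeros_cluster h c -> 0 < e ->
  exists s : seq R[i], [/\ uniq s, size s = N &
    forall a, a \in s -> 0 < normc (a - c) < e /\ h a = 0].
Proof.
move=> hc e0; elim: N => [|N [s [us sN sP]]]; first by exists [::].
have [d [d0 de dP]] := exists_separation s c e0.
have [z /andP[z0 zd] hz] := hc d d0.
exists (z :: s); split => [/=|/=|a].
- rewrite us andbT; apply/negP => /dP H.
  have : z != c by apply: contraTneq z0 => ->; rewrite subrr normc0 ltxx.
  by move=> /H; rewrite leNgt zd.
- by rewrite sN.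
- rewrite in_cons => /orP[/eqP->|/sP//].
  by rewrite z0 (lt_le_trans zd).
Qed.

(** Divide N zeros within rho / 8 of c out of h. On the circle of radius rho, where |h| <= 1, the
    quotient is at most (2 / rho)^N, hence inside as well, while within rho / 8 of c the product of
    the linear factors is at most (rho / 4)^N. So |h| <= 2^-N there for every N. *)
Lemma zeros_cluster_near (R : realType) (h : R[i] -> R[i]) (c : R[i]) (d : R) : 0 < d ->
  (forall z, normc (z - c) < d -> differentiable h z) -> zeros_cluster h c ->
  exists2 r : R, 0 < r & forall z, normc (z - c) < r -> h z = 0.
Proof.
move=> d0 dh zh.
have hcont := (continuous_epsP h c).1.
have {hcont} : {for c, continuous h}.
  by apply/differentiable_continuous/dh; rewrite subrr normc0.
move=> /continuous_epsP hcont.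
have hc : h c = 0.
  apply/eqP/contraT => hc0.
  have m0 : 0 < normc (h c).
    by rewrite lt_def normc_ge0 andbT; apply: contra hc0 => /eqP/eq0_normc/eqP.
  have [k k0 kP] := hcont _ m0.
  have [z /andP[_ zk] hz] := zh k k0.
  by have := kP z zk; rewrite hz sub0r normcN ltxx.
have [k1 k10 k1P] := hcont 1 ltr01.
have [rho [rho0 rhod rhok]] : exists rho : R, [/\ 0 < rho, rho < d & rho < k1].
  exists (Num.min d k1 / 2); set m := Num.min d k1.
  have m0 : 0 < m by rewrite lt_min d0.
  have md : m <= d by rewrite ge_min lexx.
  have mk : m <= k1 by rewrite ge_min lexx orbT.
  by split; lra.
exists (rho / 8); first by rewrite divr_gt0.
move=> z zr; apply: eq0_normc.
have bound N : normc (h z) <= 2^-1 ^+ N.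
  have [|s [us sN sP]] := @many_zeros _ h c N (rho / 8) zh; first by rewrite divr_gt0.
  have [||k [kc dk kE]] := @zeros_factor _ h [set z | normc (z - c) < d] s _ us.
  - exact: dh.
  - by move=> a /sP[/andP[_ H] ha]; split => //=; lra.
  have kz : normc (k z) <= (2 / rho) ^+ N.
    apply: (@max_modulus _ _ c rho _ s rho0) => [y yr|y yr ys|y yr|].
    - by apply: kc; rewrite /=; lra.
    - by apply: dk ys; rewrite /=; lra.
    - have yd : normc (y - c) < d by rewrite yr.
      have hy : normc (h y) <= 1.
        by have := k1P y; rewrite yr hc subr0 => /(_ rhok)/ltW.
      have py : (rho / 2) ^+ N <= \prod_(a <- s) normc (y - a).
        rewrite -sN -prod_const_seq.
        rewrite big_seq [leRHS]big_seq; apply: ler_prod => a /sP[/andP[_ ad] _].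
        rewrite divr_ge0 ?(ltW rho0)//=.
        have := normcD (y - a) (a - c); rewrite addrA subrK yr; lra.
      have py0 : 0 < (rho / 2) ^+ N by rewrite exprn_gt0// divr_gt0.
      have -> : (2 / rho) ^+ N = ((rho / 2) ^+ N)^-1 by rewrite -[RHS]exprVn invf_div.
      rewrite -[leRHS]mul1r ler_pdivlMr//; apply: le_trans hy.
      by rewrite (kE y yd) normcM normc_prod mulrC ler_wpM2r// normc_ge0.
    - by lra.
  have pz : \prod_(a <- s) normc (z - a) <= (rho / 4) ^+ N.
    rewrite -sN -prod_const_seq.
    rewrite big_seq [leRHS]big_seq; apply: ler_prod => a /sP[/andP[_ ad] _].
    rewrite normc_ge0/=.
    have := normcD (z - c) (c - a); rewrite addrA subrK [normc (c - a)]normcBC; lra.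
  rewrite kE; last by rewrite /=; lra.
  rewrite normcM normc_prod (_ : 2^-1 ^+ N = (rho / 4) ^+ N * (2 / rho) ^+ N).
    apply: ler_pM => //; last exact: normc_ge0.
    by apply: prodr_ge0 => a _; exact: normc_ge0.
  by rewrite -exprMn; congr (_ ^+ _); field; rewrite gt_eqF.
apply/eqP; rewrite eq_le normc_ge0 andbT leNgt; apply/negP => h0.
have := bound (Num.bound (normc (h z))^-1); rewrite leNgt => /negP; apply.
set N := Num.bound _.
rewrite exprVn invf_plt ?posrE ?exprn_gt0//.
apply: lt_trans (archi_boundP _) _; first by rewrite invr_ge0 ltW.
by rewrite -natrX ltr_nat ltn_expl.
Qed.

Lemma differentiable_idfun (R : realType) (z : R[i]) :
  differentiable (fun z : R[i] => z) z.
Proof. exact: (@ex_diff _ _ _ _ _ _ _ (is_diff_id z)). Qed.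

Lemma zeros_cluster_of_near (R : realType) (h : R[i] -> R[i]) (c : R[i]) (r : R) :
  0 < r -> (forall z, normc (z - c) < r -> h z = 0) -> zeros_cluster h c.
Proof.
move=> r0 hr e e0; pose m := Num.min r e / 2.
have [m0 mr me] : [/\ 0 < m, m < r & m < e].
  rewrite /m; set m' := Num.min r e.
  have ? : 0 < m' by rewrite lt_min r0.
  have ? : m' <= r by rewrite ge_min lexx.
  have ? : m' <= e by rewrite ge_min lexx orbT.
  by split; lra.
have nm : normc (c + m%:C%C - c) = m.
  by rewrite addrC addKr /= expr0n addr0 sqrtr_sqr gtr0_norm.
by exists (c + m%:C%C); [rewrite nm m0|apply: hr; rewrite nm].
Qed.

Lemma normcR (R : realType) (t : R) : normc t%:C%C = `|t|.
Proof. by rewrite /= expr0n addr0 sqrtr_sqr. Qed.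

(** Connectedness of [0, 1]: the parameters at which zeros of h accumulate form a closed set, and by
    [zeros_cluster_near] they are those near which h vanishes identically, an open condition. *)
Lemma identity_segment (R : realType) (h : R[i] -> R[i]) (c x : R[i]) :
  (forall t : R, 0 <= t <= 1 -> exists2 d : R, 0 < d &
     forall z, normc (z - (c + t%:C%C * (x - c))) < d -> differentiable h z) ->
  zeros_cluster h c -> h x = 0.
Proof.
pose g (t : R) := c + t%:C%C * (x - c).
move=> dh hc.
have gB t t' : g t' - g t = (t' - t)%:C%C * (x - c).
  by rewrite /g rmorphB/=; ring.
pose K := normc (x - c) + 1.
have K0 : 0 < K by rewrite ltr_wpDl// normc_ge0.
have gle t t' : normc (g t' - g t) <= `|t' - t| * K.
  by rewrite gB normcM normcR ler_wpM2l// lerDl.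
pose C1 : set R := [set t | exists2 e : R, 0 < e & forall z, normc (z - g t) < e -> h z = 0].
pose C2 : set R := [set t | zeros_cluster h (g t)].
have C1o : open C1.
  rewrite openE => t [e e0 eP]; apply/nbhs_ballP.
  exists (e / 2 / K) => /=; first by rewrite !divr_gt0.
  move=> t'; rewrite /ball/= distrC ltr_pdivlMr// => t't.
  exists (e / 2) => [|z zt]; first by rewrite divr_gt0.
  apply: eP; rewrite -(subrK (g t') z) -addrA; apply: le_lt_trans (normcD _ _) _.
  have := gle t t'; lra.
have C2c : closed C2.
  suff : open (~` C2) by rewrite -closedC setCK.
  rewrite openE => t tC2.
  have [e e0 eP] : exists2 e : R, 0 < e & forall z, 0 < normc (z - g t) < e -> h z <> 0.
    apply: contrapT => ne; apply: tC2 => e e0; apply: contrapT => nz.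
    by apply: ne; exists e => // z ze hz; apply: nz; exists z.
  apply/nbhs_ballP; exists (e / K) => /=; first by rewrite !divr_gt0.
  move=> t'; rewrite /ball/= distrC ltr_pdivlMr// => t't.
  have [gtt'|gtt'] := eqVneq (g t') (g t).
    by rewrite /C2 /= gtt'.
  have m0 : 0 < normc (g t' - g t).
    rewrite lt_def normc_ge0 andbT; apply: contra gtt' => /eqP/eq0_normc/eqP.
    by rewrite subr_eq0.
  have me : normc (g t' - g t) < e by apply: le_lt_trans (gle _ _) t't.
  (* This radius around [g t'] keeps the zero distinct from [g t] and within e of it. *)
  move=> /(_ (Num.min (normc (g t' - g t)) (e - normc (g t' - g t))))[].
    by rewrite lt_min m0 subr_gt0.
  move=> z /andP[_]; rewrite lt_min => /andP[z1 z2]; apply: eP; apply/andP; split.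
    have := normcD (g t' - z) (z - g t); rewrite addrA subrK.
    by move: z1; rewrite [normc (z - g t')]normcBC; lra.
  rewrite -(subrK (g t') z) -addrA; apply: le_lt_trans (normcD _ _) _; lra.
have C12 t : 0 <= t <= 1 -> C2 t -> C1 t.
  by move=> /dh[d d0 dP] tC2; have [r r0 rP] := zeros_cluster_near d0 dP tC2; exists r.
have C21 t : C1 t -> C2 t by move=> [r r0]; exact: zeros_cluster_of_near.
have B01 : [set t | 0 <= t <= 1 /\ C2 t] = `[0, 1]%classic.
  apply: segment_connected.
  - by exists 0; split; rewrite ?lexx ?ler01//= /C2 /g /= mul0r addr0.
  - exists C1 => //; apply/seteqP; split => t /=; rewrite in_itv/=.
      by move=> [t01 tC2]; split => //; exact: C12.
    by move=> [t01 /C21].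
  - exists C2 => //; apply/seteqP; split => t /=; rewrite in_itv/=; by case.
have : `[0, 1]%classic (1 : R) by rewrite /= in_itv/= ler01 lexx.
rewrite -B01 => -[_ /(C12 _) C11]; have [|r r0 rP] := C11.
  by rewrite ler01 lexx.
have g1 : g 1 = x by rewrite /g mul1r addrC subrK.
by apply: rP; rewrite g1 subrr normc0.
Qed.

Lemma normc_convex (R : realType) (z c x : R[i]) (t r : R) : 0 <= t <= 1 ->
  normc (c - z) < r -> normc (x - z) < r ->
  normc (c + t%:C%C * (x - c) - z) < r.
Proof.
move=> /andP[t0 t1] cr xr.
rewrite (_ : _ - z = (1 - t)%:C%C * (c - z) + t%:C%C * (x - z)); last first.
  by rewrite rmorphB/=; ring.
apply: le_lt_trans (normcD _ _) _.
rewrite !normcM !normcR !ger0_norm ?subr_ge0//.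
have [->|tn1] := eqVneq t 1; first by rewrite subrr mul0r add0r mul1r.
have : 0 < (1 - t) * (r - normc (c - z)).
  by rewrite mulr_gt0// subr_gt0// lt_neqAle tn1.
have : 0 <= t * (r - normc (x - z)) by rewrite mulr_ge0// subr_ge0 ltW.
lra.
Qed.

(* At the fixed point s, f = 1 - h(z)/z vanishes while Re f >= 0, so that
   Schwarz's lemma applies to f / (f + 2e) for every e > 0 and gives f = 0
   near s when e tends to 0. *)
Lemma schwarz_fixed_point (R : realType) (h : R[i] -> R[i]) (s : R[i]) :
  (forall z, normc z < 1 -> differentiable h z) ->
  (forall z, normc z < 1 -> normc (h z) <= 1) ->
  h 0 = 0 -> 0 < normc s < 1 -> h s = s ->
  forall z, normc z < 1 -> h z = z.
Proof.
move=> dh h1 h0 /andP[s0 s1] hs.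
have hz z : normc z < 1 -> normc (h z) <= normc z.
  move=> z1; rewrite -[leRHS]divr1 -[z in normc z / _]subr0.
  by apply: (@schwarz_bound _ h 0 1) => [//|y|y|//|]; rewrite ?subr0; [exact: dh|exact: h1|].
have [d [d0 ds d1]] : exists d : R, [/\ 0 < d, d <= normc s & d <= 1 - normc s].
  exists (Num.min (normc s) (1 - normc s)); split.
  - by rewrite lt_min s0 subr_gt0.
  - by rewrite ge_min lexx.
  - by rewrite ge_min lexx orbT.
pose f z := 1 - z^-1 * h z.
have near_s z : normc (z - s) < d -> z != 0 /\ normc z < 1.
  move=> zs; split.
    by apply: contraTneq zs => ->; rewrite sub0r normcN -leNgt.
  by rewrite -(subrK s z); apply: le_lt_trans (normcD _ _) _; lra.
have Ref z : normc (z - s) < d -> 0 <= Re (f z).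
  move=> /near_s[z0 z1].
  have nz0 : 0 < normc z.
    by rewrite lt_def normc_ge0 andbT; apply: contra z0 => /eqP/eq0_normc/eqP.
  have : normc (z^-1 * h z) <= 1.
    by rewrite normcM normcV mulrC ler_pdivrMr// mul1r hz.
  move=> /(le_trans (Re_le_normc _)); rewrite /f ler_norml.
  by case: (z^-1 * h z) => a b /=; lra.
have feps z (e : R) : normc (z - s) < d -> 0 < e ->
    0 < normc (f z + (2 * e)%:C%C) /\ normc (f z) <= normc (f z + (2 * e)%:C%C).
  move=> /Ref + e0; case: (f z) => a b /= a0; split.
    by rewrite sqrtr_gt0 addr0 ltr_pwDl ?sqr_ge0// exprn_gt0//; lra.
  rewrite addr0 ler_sqrt ?addr_ge0 ?sqr_ge0// lerD2r ler_sqr ?nnegrE; lra.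
have f0 z : normc (z - s) < d -> f z = 0.
  move=> zs; apply/eq0_normc/eqP; rewrite eq_le normc_ge0 andbT leNgt.
  apply/negP => fz0; set rho := normc (z - s) / d.
  have rho1 : rho < 1 by rewrite ltr_pdivrMr// mul1r.
  have rho0 : 0 <= rho by rewrite divr_ge0 ?normc_ge0// ltW.
  have bound (e : R) : 0 < e -> normc (f z) <= rho * normc (f z + (2 * e)%:C%C).
    move=> e0; have [fe0 _] := feps z e zs e0.
    rewrite -ler_pdivrMr// -normcV mulrC -normcM mulrC.
    rewrite /rho; apply: (@schwarz_bound _ (fun z => f z * (f z + (2 * e)%:C%C)^-1) s d d0 _ _ _ z zs).
    - move=> y ys; have [y0 y1] := near_s y ys.
      have dhy := dh y y1.
      have dfy : differentiable f y.
        apply: differentiableB; first exact: differentiable_cst.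
        apply: differentiableM dhy; apply: differentiableV y0.
        exact: differentiable_idfun.
      apply: (differentiableM dfy); apply: differentiableV.
        by apply: (differentiableD dfy); exact: differentiable_cst.
      have [fe _] := feps y e ys e0.
      by apply: contraTneq fe => ->; rewrite normc0 ltxx.
    - move=> y ys; have [fe H] := feps y e ys e0.
      by rewrite normcM normcV ler_pdivrMr// mul1r.
    - by rewrite /f hs mulVf ?subrr ?mul0r//; have [] := near_s s; rewrite ?subrr ?normc0.
  (* An explicit e in place of the limit: rho (1 + (1 - rho) / 2) < 1 contradicts the bound. *)
  have := bound ((1 - rho) * normc (f z) / 4).
  rewrite divr_gt0 ?mulr_gt0 ?subr_gt0// => /(_ isT).
  apply/negP; rewrite -ltNge.
  apply: le_lt_trans (ler_wpM2l rho0 (normcD _ _)) _.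
  rewrite normcR ger0_norm; last by rewrite mulr_ge0// divr_ge0// mulr_ge0 ?(ltW fz0)// subr_ge0 ltW.
  rewrite (_ : 2 * _ = (1 - rho) * normc (f z) / 2); last by field.
  have := mulr_gt0 (_ : 0 < 1 - rho) fz0; rewrite subr_gt0 => /(_ rho1).
  set m := normc (f z) in fz0 *; nra.
move=> z z1; apply/eqP; rewrite -subr_eq0; apply/eqP.
(* From the vicinity of s the equality spreads to z along a segment in the disc. *)
apply: (@identity_segment _ (fun z => h z - z) s z).
  move=> t t01; exists (1 - normc (s + t%:C%C * (z - s))).
    rewrite subr_gt0 -[X in normc X]subr0; apply: normc_convex => //; rewrite subr0//.
  move=> y; rewrite ltrBrDr => /(le_lt_trans (normcD _ _)); rewrite subrK => y1.
  apply: differentiableB (dh y y1) _; exact: differentiable_idfun.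
apply: (zeros_cluster_of_near d0) => y ys; have [y0 _] := near_s y ys.
have := f0 y ys; rewrite /f => /eqP; rewrite subr_eq0 => /eqP.
by move=> /(congr1 (fun u => y * u)); rewrite mulr1 mulrA mulfV// mul1r => <-; rewrite subrr.
Qed.

(** * Holomorphic functions on convex open sets *)

Lemma convex_segment (R : realType) (V : lmodType R[i]) (D : set V) (x y : V) (t : R) :
  convex_set D -> D x -> D y -> 0 <= t <= 1 -> D (x + t%:C%C *: (y - x)).
Proof.
move=> Dc Dx Dy /andP[t0 t1].
have t0C : 0 <= t%:C%C by rewrite lecR.
have t1C : t%:C%C <= 1 by rewrite -(@lecR R) in t1.
have := Dc y x (Itv01 t0C t1C) (mem_set Dy) (mem_set Dx).
move/set_mem; congr D.
by rewrite /conv/= /unstable.onem scalerBr scalerBl scale1r addrCA.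
Qed.

Section line.
Variables (R : realType) (V : normedModType R[i]).
Implicit Types (D : set V) (p v : V).

Lemma differentiable_line p v (s : R[i]) : differentiable (fun s : R[i] => p + s *: v) s.
Proof.
apply: differentiableD; first exact: differentiable_cst.
exact/differentiableZl/differentiable_idfun.
Qed.

Lemma open_line D p v (s : R[i]) : open D -> D (p + s *: v) ->
  exists2 d : R, 0 < d & forall s', normc (s' - s) < d -> D (p + s' *: v).
Proof.
move=> Do Ds; have := differentiable_continuous (differentiable_line p v s).
have : nbhs (p + s *: v) D by apply: open_nbhs_nbhs.
move=> nD /(_ _ nD) /nbhs_ballP[[d d'] /=]; rewrite ltcE /= => /andP[/eqP-> d0] dP.
exists d => // s' s's; apply: dP.
by rewrite /ball/= distrC ltcR.
Qed.

(** Convexity keeps the image of the segment from s0 to s1 in D, so [identity_segment] applies to F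
    - G restricted to the complex line. *)
Lemma line_identity D (F G : V -> R[i]) p v (s0 s1 : R[i]) : open D -> convex_set D ->
  (forall x, D x -> differentiable F x) -> (forall x, D x -> differentiable G x) ->
  D (p + s0 *: v) -> D (p + s1 *: v) ->
  (forall e : R, 0 < e -> exists2 s, 0 < normc (s - s0) < e & F (p + s *: v) = G (p + s *: v)) ->
  F (p + s1 *: v) = G (p + s1 *: v).
Proof.
move=> Do Dc dF dG D0 D1 FG; apply/eqP; rewrite -subr_eq0; apply/eqP.
apply: (@identity_segment _ (fun s => F (p + s *: v) - G (p + s *: v)) s0 s1).
  move=> t t01; have := convex_segment Dc D0 D1 t01.
  have -> : p + s0 *: v + t%:C%C *: (p + s1 *: v - (p + s0 *: v)) =
      p + (s0 + t%:C%C * (s1 - s0)) *: v.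
    by rewrite opprD addrACA subrr add0r -scalerBl scalerA scalerDl addrA.
  move=> /(open_line Do)[d d0 dP]; exists d; first exact: d0.
  move=> s /dP Ds.
  have dl := differentiable_line p v s.
  by apply: differentiableB; apply: (differentiable_comp dl); [exact: dF|exact: dG].
move=> e /FG[s se Fs]; exists s => //.
by rewrite Fs subrr.
Qed.

(* Induction on the number of points: moving p by th towards a new point x of X
   moves every other point x_j to x_j + th (x - x_j) and scales x_j - p by the
   factor 1 - th. *)
Lemma constant_on_complex_affine_hull D (X : set V) (F : V -> R[i]) (a : R[i]) :
  open D -> convex_set D -> (forall x, D x -> differentiable F x) ->
  X `<=` D -> (forall x y (t : R), X x -> X y -> 0 <= t <= 1 -> X (x + t%:C%C *: (y - x))) ->
  (forall x, X x -> F x = a) ->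
  forall (us : seq (R[i] * V)) p, X p -> (forall u, u \in us -> X u.2) ->
    D (p + \sum_(u <- us) u.1 *: (u.2 - p)) ->
    F (p + \sum_(u <- us) u.1 *: (u.2 - p)) = a.
Proof.
move=> Do Dc dF XD Xc FX us.
have da (x : V) : D x -> differentiable (fun _ : V => a) x.
  by move=> _; exact: differentiable_cst.
(* Induction on a bound for the size: the hypothesis will be applied to [ust], a list of moved
   points with another base point, rather than to [us]. *)
have [k] := ubnP (size us); elim: k us => [//|k IH] [_ p Xp _ _|[c x] us].
  by rewrite big_nil addr0; exact: FX.
rewrite /= ltnS => usk p Xp usX.
have Xx : X x by exact: (usX (c, x) (mem_head _ _)).
have {}usX u : u \in us -> X u.2 by move=> uus; apply: usX; rewrite in_cons uus orbT.
rewrite big_cons /=; set A := \sum_(u <- us) _; set y := _ + A => Dy.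
have Dp0 (v : V) : D (p + 0 *: v) by rewrite scale0r addr0; exact: XD.
rewrite -[y]scale1r.
(* The partial sum A may lead out of D. By the identity theorem on the line from p to p + y it is
   enough to treat p + s y for small s > 0, where p + s A lies in D. *)
apply: (@line_identity D F (fun=> a) p y 0 1 Do Dc dF da (Dp0 _)); first by rewrite scale1r.
have [d d0 dP] := open_line Do (Dp0 A).
move=> e e0.
have [s [s0 sd s1 se]] : exists s : R, [/\ 0 < s, s < d, s <= 1 & s < e].
  exists (Num.min (Num.min d e) 1 / 2); set m := Num.min _ _.
  have m0 : 0 < m by rewrite !lt_min d0 e0 ltr01.
  have md : m <= d by rewrite !ge_min lexx.
  have me : m <= e by rewrite !ge_min lexx orbT.
  have m1 : m <= 1 by rewrite ge_min lexx orbT.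
  by split; lra.
have ns : normc (s%:C%C - 0) = s by rewrite subr0 normcR gtr0_norm.
exists s%:C%C; first by rewrite ns s0.
have DsA : D (p + s%:C%C *: A) by apply: dP; rewrite ns.
have Dsy : D (p + s%:C%C *: y).
  have := convex_segment Dc (XD _ Xp) Dy (_ : 0 <= s <= 1).
  by rewrite (ltW s0) s1 [p + y]addrC addrK; apply.
have syE : p + s%:C%C *: y = p + s%:C%C *: A + (s%:C%C * c) *: (x - p).
  by rewrite /y scalerDr scalerA addrA addrAC.
rewrite syE; rewrite syE in Dsy.
have DsA0 : D (p + s%:C%C *: A + 0 *: (x - p)) by rewrite scale0r addr0.
(* A second line, through p + s A in the direction x - p; small t > 0 is enough again. *)
apply: (@line_identity D F (fun=> a) _ _ 0 _ Do Dc dF da DsA0 Dsy).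
have [d' d'0 d'P] := open_line Do DsA0.
move=> e' e'0.
have [t [t0 td t1 te]] : exists t : R, [/\ 0 < t, t < d', t < 1 & t < e'].
  exists (Num.min (Num.min d' e') 1 / 2); set m := Num.min _ _.
  have m0 : 0 < m by rewrite !lt_min d'0 e'0 ltr01.
  have md : m <= d' by rewrite !ge_min lexx.
  have me : m <= e' by rewrite !ge_min lexx orbT.
  have m1 : m <= 1 by rewrite ge_min lexx orbT.
  by split; lra.
have nt : normc (t%:C%C - 0) = t by rewrite subr0 normcR gtr0_norm.
exists t%:C%C; first by rewrite nt t0.
have Dt : D (p + s%:C%C *: A + t%:C%C *: (x - p)) by apply: d'P; rewrite nt.
pose pt := p + t%:C%C *: (x - p).
(* Dividing the coefficients by 1 - t compensates for the shrinking of the differences, so that the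
   sum over [ust] is s A and the induction hypothesis covers pt + s A. *)
pose ust := [seq (s%:C%C * u.1 / (1 - t)%:C%C, u.2 + t%:C%C *: (x - u.2)) | u <- us].
have t01 : 0 <= t <= 1 by rewrite !ltW.
have tn1 : (1 - t)%:C%C != 0 :> R[i].
  by rewrite (inj_eq (@complexI R)) subr_eq0 gt_eqF.
have sumE : \sum_(u <- ust) u.1 *: (u.2 - pt) = s%:C%C *: A.
  rewrite big_map scaler_sumr; apply: eq_bigr => -[b q] _ /=.
  have -> : q + t%:C%C *: (x - q) - pt = (1 - t)%:C%C *: (q - p).
    rewrite /pt opprD addrACA -scalerBr opprB [x - q + _]addrC addrA subrK.
    by rewrite rmorphB/= scalerBl scale1r -scalerN opprB.
  by rewrite !scalerA divfK.
have := IH ust _ pt (Xc _ _ _ Xp Xx t01) _.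
rewrite sumE /pt addrAC => -> //; first by rewrite size_map.
by move=> u /mapP[v vus ->] /=; apply: Xc => //; exact: usX.
Qed.

End line.

(** * Left inverses *)

Section continuity_of_determinants.
Variable R : realType.

Lemma continuous_bigsum (I : Type) (r : seq I) (F : I -> R[i] -> R[i]) (z : R[i]) :
  (forall i, {for z, continuous (F i)}) ->
  {for z, continuous (fun t => \sum_(i <- r) F i t)}.
Proof.
move=> Fc; elim: r => [|i r IH].
  rewrite (_ : (fun t => _) = fun=> 0); first exact: cst_continuous.
  by apply/funext => t; rewrite big_nil.
rewrite (_ : (fun t => _) = fun t => F i t + \sum_(i <- r) F i t).
  exact: (continuousD (Fc i) IH).
by apply/funext => t; rewrite big_cons.
Qed.

Lemma continuous_bigprod (I : Type) (r : seq I) (F : I -> R[i] -> R[i]) (z : R[i]) :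
  (forall i, {for z, continuous (F i)}) ->
  {for z, continuous (fun t => \prod_(i <- r) F i t)}.
Proof.
move=> Fc; elim: r => [|i r IH].
  rewrite (_ : (fun t => _) = fun=> 1); first exact: cst_continuous.
  by apply/funext => t; rewrite big_nil.
rewrite (_ : (fun t => _) = fun t => F i t * \prod_(i <- r) F i t).
  exact: (continuousM (Fc i) IH).
by apply/funext => t; rewrite big_cons.
Qed.

Lemma continuous_det (n : nat) (A : R[i] -> 'M[R[i]]_n) (z : R[i]) :
  (forall i j, {for z, continuous (fun t => A t i j)}) ->
  {for z, continuous (fun t => \det (A t))}.
Proof.
move=> Ac; rewrite /determinant; apply: continuous_bigsum => s.
apply: continuousM; first exact: cst_continuous.
by apply: continuous_bigprod => i; exact: Ac.
Qed.

Lemma continuous_cofactor (n : nat) (A : R[i] -> 'M[R[i]]_n) (i j : 'I_n) (z : R[i]) :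
  (forall i j, {for z, continuous (fun t => A t i j)}) ->
  {for z, continuous (fun t => cofactor (A t) i j)}.
Proof.
move=> Ac; rewrite /cofactor; apply: continuousM; first exact: cst_continuous.
apply: continuous_det => k l.
have -> : (fun t => row' i (col' j (A t)) k l) = fun t => A t (lift i k) (lift j l).
  by apply/funext => t; rewrite !mxE.
exact: Ac.
Qed.

(** By Cramer's rule, the function is the j-th coordinate of u(t) A(t)^-1 wherever A(t) is
    invertible. *)
Lemma continuous_cramer (n : nat) (A : R[i] -> 'M[R[i]]_n) (u : R[i] -> 'rV[R[i]]_n)
    (j : 'I_n) (z : R[i]) :
  (forall i j, {for z, continuous (fun t => A t i j)}) ->
  (forall j, {for z, continuous (fun t => u t ord0 j)}) -> \det (A z) != 0 ->
  {for z, continuous (fun t => (\det (A t))^-1 * (u t *m \adj (A t)) ord0 j)}.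
Proof.
move=> Ac uc dA.
have hdet : {for z, continuous (fun t => (\det (A t))^-1)}.
  exact: (@continuousV _ _ (fun t => \det (A t)) z dA (continuous_det Ac)).
apply: (continuousM hdet).
have -> : (fun t => (u t *m \adj (A t)) ord0 j) =
    fun t => \sum_k u t ord0 k * cofactor (A t) j k.
  by apply/funext => t; rewrite mxE; apply: eq_bigr => k _; rewrite mxE.
apply: continuous_bigsum => k; apply: continuousM; first exact: uc.
exact: continuous_cofactor.
Qed.

End continuity_of_determinants.

Lemma unit_discE (R : realType) (z : R[i]) : unit_disc R z = (normc z < 1) :> Prop.
Proof. by rewrite /unit_disc /= -ltcR. Qed.

Section left_inverses.
Variables (R : realType) (n : nat) (D : set 'rV[R[i]]_n).
Hypothesis D_convex : convex_domain D.
Variables (w z : 'rV[R[i]]_n) (sigma : R[i]).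
Hypotheses (sigma_disc : unit_disc R sigma) (sigma_neq0 : sigma <> 0).

(** Geodesics are replaced by all holomorphic discs through w and z, a class visibly closed under
    convex combinations. *)
Definition disc_through (g : R[i] -> 'rV[R[i]]_n) :=
  [/\ holomorphic_map (unit_disc R) D g, g 0 = w & g sigma = z].

(** Since F(w) = 0 and F(z) = sigma, the self-map F o g of the disc fixes 0 and sigma, and Schwarz's
    lemma makes it the identity. *)
Lemma left_inverse_of_disc_through (F : 'rV[R[i]]_n -> R[i]) g :
  left_inverse_through D w z sigma F -> disc_through g -> holo_left_inverse D g F.
Proof.
move=> [f [_ f0 fs] [[FD dF] Ff]] [[gD dg] g0 gs]; split; first by split.
have disc0 : unit_disc R 0 by rewrite unit_discE normc0.
move=> lam; rewrite unit_discE => lam1.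
apply: (@schwarz_fixed_point _ (F \o g) sigma) lam1.
- move=> y; rewrite -unit_discE => y1.
  by apply: differentiable_comp; [exact: dg|exact/dF/gD].
- by move=> y; rewrite -unit_discE => /gD/FD; rewrite unit_discE => /ltW.
- by rewrite /= g0 -f0 Ff.
- have -> : normc sigma < 1 by rewrite -unit_discE.
  rewrite andbT.
  rewrite lt_def normc_ge0 andbT; apply/eqP => /eq0_normc; exact: sigma_neq0.
- by rewrite /= gs -fs Ff.
Qed.

Lemma disc_through_convex g h (t : R) : 0 <= t <= 1 ->
  disc_through g -> disc_through h -> disc_through (fun y => g y + t%:C%C *: (h y - g y)).
Proof.
case: D_convex => _ _ _ Dc t01 [[gD dg] g0 gs] [[hD dh] h0 hs].
split; last 2 first.
- by rewrite h0 g0 subrr scaler0 addr0.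
- by rewrite hs gs subrr scaler0 addr0.
split=> y y1; first exact: convex_segment Dc (gD y y1) (hD y y1) t01.
apply: differentiableD; first exact: dg.
by apply: differentiableZ; apply: differentiableB; [exact: dh|exact: dg].
Qed.

Lemma left_inverse_on_hull (F : 'rV[R[i]]_n -> R[i]) (lam : R[i]) g
    (I : finType) (c : I -> R[i]) (h : I -> R[i] -> 'rV[R[i]]_n) :
  left_inverse_through D w z sigma F -> unit_disc R lam -> disc_through g ->
  (forall i, disc_through (h i)) ->
  D (g lam + \sum_i c i *: (h i lam - g lam)) ->
  F (g lam + \sum_i c i *: (h i lam - g lam)) = lam.
Proof.
move=> FL lam1 gT hT; case: D_convex => Do _ _ Dc.
pose X : set 'rV[R[i]]_n := [set x | exists2 g, disc_through g & x = g lam].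
have sumE : \sum_i c i *: (h i lam - g lam) =
    \sum_(u <- [seq (c i, h i lam) | i <- index_enum I]) u.1 *: (u.2 - g lam).
  by rewrite big_map.
rewrite sumE; apply: (@constant_on_complex_affine_hull _ _ D X).
- exact: Do.
- exact: Dc.
- by case: FL => f _ [[_ dF] _]; exact: dF.
- by move=> _ [k [[kD _] _ _] ->]; exact: kD.
- move=> _ _ t [k1 k1T ->] [k2 k2T ->] t01.
  exists (fun y => k1 y + t%:C%C *: (k2 y - k1 y)); last by [].
  exact: disc_through_convex.
- by move=> _ [k kT ->]; have [_] := left_inverse_of_disc_through FL kT; apply.
- by exists g.
- by move=> u /mapP[i _ ->]; exists (h i).
Qed.

End left_inverses.

(** Freeness forces the coefficient of [e] to be nonzero, so the relation can be solved for [e].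
    This serves the case where the determinant of [chord_mx] vanishes. *)
Lemma free_lift_span (K : fieldType) (m : nat) (V : vectType K) (v : 'I_m -> V) (e : V)
    (c : 'I_m.+1 -> K) : free [tuple v i | i < m] ->
  c ord0 *: e + \sum_i c (lift ord0 i) *: v i = 0 -> (exists i, c i != 0) ->
  e = \sum_i (- ((c ord0)^-1 * c (lift ord0 i))) *: v i.
Proof.
move=> /freeP fv ce [i ci].
have c0 : c ord0 != 0.
  apply: contra ci => /eqP c0; rewrite c0 scale0r add0r in ce.
  have [j ->|->] := unliftP ord0 i; last by rewrite c0.
  apply/eqP; apply: (fv (fun j => c (lift ord0 j))).
  by rewrite -[RHS]ce; apply: eq_bigr => k _; rewrite -tnth_nth tnth_mktuple.
have -> : \sum_i (- ((c ord0)^-1 * c (lift ord0 i))) *: v i =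
    (c ord0)^-1 *: - \sum_i c (lift ord0 i) *: v i.
  by rewrite -sumrN scaler_sumr; apply: eq_bigr => k _; rewrite scaleNr scalerN scalerA.
move/eqP: ce; rewrite addr_eq0 => /eqP <-.
by rewrite scalerA mulVf// scale1r.
Qed.

(** * Intersections of a complex line with the moving hyperplane *)

Section uniqueness.
Variables (R : realType) (m : nat) (D : set 'rV[R[i]]_m.+1).
Hypothesis D_convex : convex_domain D.
Variables (w z : 'rV[R[i]]_m.+1) (sigma : R[i]).
Hypotheses (sigma_disc : unit_disc R sigma) (sigma_neq0 : sigma <> 0).
Variables (g : R[i] -> 'rV[R[i]]_m.+1) (h : 'I_m -> R[i] -> 'rV[R[i]]_m.+1).
Hypotheses (gT : disc_through D w z sigma g) (hT : forall i, disc_through D w z sigma (h i)).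
Variable lam0 : R[i].
Hypotheses (lam0_disc : unit_disc R lam0)
  (gh_free : free [tuple h i lam0 - g lam0 | i < m]).

(** The rows below [e] span the direction of H_lam. A nonzero determinant says that H_lam is a
    hyperplane and that [e] is transverse to it. *)
Definition chord_mx (e : 'rV[R[i]]_m.+1) (lam : R[i]) : 'M[R[i]]_m.+1 :=
  \matrix_(i < m.+1) (if unlift ord0 i is Some j then h j lam - g lam else e).

Lemma mul_chord_mx e lam (c : 'rV[R[i]]_m.+1) : c *m chord_mx e lam =
  c ord0 ord0 *: e + \sum_i c ord0 (lift ord0 i) *: (h i lam - g lam).
Proof.
rewrite mulmx_sum_row big_ord_recl rowK unlift_none; congr (_ + _).
by apply: eq_bigr => i _; rewrite rowK liftK.
Qed.

Lemma differentiable_entry (k : R[i] -> 'rV[R[i]]_m.+1) (lam : R[i]) (j : 'I_m.+1) :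
  differentiable k lam -> differentiable (fun t => k t ord0 j) lam.
Proof.
move=> dk.
exact: (@differentiable_comp _ _ _ _ k (fun N : 'rV[R[i]]_m.+1 => N ord0 j) lam dk
  (differentiable_coord _ _ _)).
Qed.

Lemma left_inverse_unique (F G : 'rV[R[i]]_m.+1 -> R[i]) (x : 'rV[R[i]]_m.+1) :
  left_inverse_through D w z sigma F -> left_inverse_through D w z sigma G ->
  D x -> F x = G x.
Proof.
move=> FL GL Dx; have [Do _ _ Dc] := D_convex.
pose p := g lam0; pose e := x - p.
have Dp : D p by case: gT => -[gD _] _ _; exact: gD.
have xE : x = p + e by rewrite /e addrC subrK.
have on_hull E lam c : left_inverse_through D w z sigma E -> unit_disc R lam ->
    D (g lam + \sum_i c i *: (h i lam - g lam)) ->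
    E (g lam + \sum_i c i *: (h i lam - g lam)) = lam.
  by move=> EL lam1; exact: (left_inverse_on_hull D_convex sigma_disc sigma_neq0 EL lam1 gT hT).
(* In the singular case e is a combination of the chords, so x lies in H_lam0, where both functions
   equal lam0. *)
have [/eqP/det0P[c c0 cM]|det0] := eqVneq (\det (chord_mx e lam0)) 0.
  rewrite mul_chord_mx in cM.
  have ci : exists i, c ord0 i != 0 by apply/rV0Pn.
  have eE := free_lift_span gh_free cM ci.
  by rewrite xE eE in Dx *; rewrite !on_hull.
have diff_g : differentiable g lam0 by case: gT => -[_ dg] _ _; exact: dg.
have diff_h i : differentiable (h i) lam0 by case: (hT i) => -[_ dh] _ _; exact: dh.
have cont_u j : {for lam0, continuous (fun t => (g t - p) ord0 j)}.
  apply/differentiable_continuous/differentiable_entry.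
  by apply: differentiableB; [exact: diff_g|exact: differentiable_cst].
have cont_M i j : {for lam0, continuous (fun t => chord_mx e t i j)}.
  have -> : (fun t => chord_mx e t i j) =
      fun t => (if unlift ord0 i is Some k then h k t - g t else e) ord0 j.
    by apply/funext => t; rewrite mxE.
  case: (unlift ord0 i) => [k|]; last exact: cst_continuous.
  apply/differentiable_continuous/differentiable_entry.
  by apply: differentiableB; [exact: diff_h|exact: diff_g].
(* [a lam] holds the coordinates of g(lam) - p in the rows of [chord_mx e lam]. Moving the chords to
   the other side shows that p + s(lam) e is the point of H_lam on the line. *)
pose a lam := (\det (chord_mx e lam))^-1 *: ((g lam - p) *m \adj (chord_mx e lam)).
pose s lam := (\det (chord_mx e lam))^-1 *
  ((g lam - p) *m \adj (chord_mx e lam)) ord0 ord0.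
have aE lam : \det (chord_mx e lam) != 0 ->
    p + s lam *: e = g lam + \sum_i (- a lam ord0 (lift ord0 i)) *: (h i lam - g lam).
  move=> dl; have : a lam *m chord_mx e lam = g lam - p.
    rewrite /a -scalemxAl -mulmxA mul_adj_mx mul_mx_scalar scalerA mulVf//.
    by rewrite scale1r.
  rewrite mul_chord_mx (_ : a lam ord0 ord0 = s lam); last by rewrite mxE.
  move=> H; under eq_bigr do rewrite scaleNr.
  rewrite sumrN; apply/eqP; rewrite eq_sym subr_eq -addrA H addrC subrK.
  by [].
have cont_s : {for lam0, continuous s} by exact: continuous_cramer.
have s0 : s lam0 = 0 by rewrite /s /p subrr mul0mx mxE mulr0.
have D0 : D (p + 0 *: e) by rewrite scale0r addr0.
have D1 : D (p + 1 *: e) by rewrite scale1r -xE.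
have [d d0 dP] := open_line Do D0.
have dF E : left_inverse_through D w z sigma E -> forall y, D y -> differentiable E y.
  by case=> f _ [[_ dE] _]; exact: dE.
rewrite xE -[e]scale1r.
apply: (line_identity Do Dc (dF F FL) (dF G GL) D0 D1) => r r0.
have n0 : 0 < normc (\det (chord_mx e lam0)).
  by rewrite lt_def normc_ge0 andbT; apply: contra det0 => /eqP/eq0_normc/eqP.
have [k1 k10 k1P] := (continuous_epsP _ _).1 (continuous_det cont_M) _ n0.
(* One bound on |s(lam)| keeps the point in D and the parameter within r of 0. *)
have [|k2 k20 k2P] := (continuous_epsP _ _).1 cont_s (Num.min d r).
  by rewrite lt_min d0.
have k30 : 0 < 1 - normc lam0 by rewrite subr_gt0 -unit_discE.
have [t [t0 t1 t2 t3]] : exists t : R, [/\ 0 < t, t < k1, t < k2 & t < 1 - normc lam0].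
  exists (Num.min (Num.min k1 k2) (1 - normc lam0) / 2); set q := Num.min _ _.
  have q0 : 0 < q by rewrite !lt_min k10 k20 k30.
  have q1 : q <= k1 by rewrite !ge_min lexx.
  have q2 : q <= k2 by rewrite !ge_min lexx orbT.
  have q3 : q <= 1 - normc lam0 by rewrite ge_min lexx orbT.
  by split; lra.
pose lam := lam0 + t%:C%C.
have nlam : normc (lam - lam0) = t by rewrite addrC addKr normcR gtr0_norm.
have lam_disc : unit_disc R lam.
  rewrite unit_discE; apply: le_lt_trans (normcD _ _) _.
  by rewrite normcR gtr0_norm//; lra.
have dlam : \det (chord_mx e lam) != 0.
  have := k1P lam; rewrite nlam => /(_ t1); apply: contraTneq => ->.
  by rewrite sub0r normcN ltxx.
have := k2P lam; rewrite nlam => /(_ t2); rewrite s0 lt_min => /andP[sd sr].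
have Ds : D (p + s lam *: e) by exact: dP.
have Es E : left_inverse_through D w z sigma E -> E (p + s lam *: e) = lam.
  by move=> EL; rewrite aE// in Ds *; exact: on_hull.
have Ep : F p = lam0.
  by have [_] := left_inverse_of_disc_through sigma_disc sigma_neq0 FL gT; apply.
exists (s lam); last by rewrite !Es.
(* If s(lam) were 0, then F(p) would be both lam and lam0. *)
rewrite sr andbT lt_def normc_ge0 andbT; apply/eqP => /eq0_normc; rewrite subr0 => sl0.
have := Es F FL; rewrite sl0 scale0r addr0 Ep => lamE.
by move: nlam t0; rewrite -lamE subrr normc0 => <-; rewrite ltxx.
Qed.

End uniqueness.

(* The geodesics f^1, ..., f^n are f 1, ..., f n.  The two conjuncts of the
   conclusion are the parenthetical "some (equivalently, any)" and the
   existence and uniqueness, as a function on D, of the left inverse. *)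
Theorem theorem4p1 (R : realType) (n : nat) (n_ge2 : (2 <= n)%N)
    (D : set 'rV[R[i]]_n) (D_convex : convex_domain D)
    (w z : 'rV[R[i]]_n) (w_in_D : D w) (z_in_D : D z)
    (sigma : R[i]) (sigma_in_disc : unit_disc R sigma)
    (sigma_neq0 : sigma <> 0)
    (f : nat -> R[i] -> 'rV[R[i]]_n)
    (f_geodesic : forall j, (1 <= j <= n)%N ->
       geodesic_through D w z sigma (f j))
    (f_indep : exists2 lambda : R[i], unit_disc R lambda &
       free [seq f j lambda - f n lambda | j <- index_iota 1 n]) :
  (forall F : 'rV[R[i]]_n -> R[i],
     left_inverse_through D w z sigma F <->
     (forall g : R[i] -> 'rV[R[i]]_n,
        geodesic_through D w z sigma g -> holo_left_inverse D g F)) /\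
  (exists2 F : 'rV[R[i]]_n -> R[i],
     left_inverse_through D w z sigma F &
     forall G : 'rV[R[i]]_n -> R[i],
       left_inverse_through D w z sigma G -> forall x, D x -> G x = F x).
Proof.
have disc_of_geodesic g : geodesic_through D w z sigma g -> disc_through D w z sigma g.
  by move=> [[gD _] g0 gs]; split.
have f1 : geodesic_through D w z sigma (f 1%N) by apply: f_geodesic; rewrite (ltnW n_ge2).
split.
  move=> F; split=> [FL g /disc_of_geodesic|FA].
    exact: (left_inverse_of_disc_through sigma_in_disc sigma_neq0 FL).
  by exists (f 1%N); [exact: f1|exact: FA].
have [[_ [F FL]] _ _] := f1.
have FT : left_inverse_through D w z sigma F by exists (f 1%N).
exists F; first exact: FT.
move=> G GT x Dx.
case: n => [|m] in n_ge2 D D_convex w z w_in_D z_in_D f f_geodesic f_indep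
    disc_of_geodesic f1 F FL FT G GT x Dx *; first by [].
have [lam0 lam0_disc f_free] := f_indep.
(* f^n is the base disc; ordinals start at 0, hence the shift to [f i.+1]. *)
apply: (@left_inverse_unique _ m D D_convex w z sigma sigma_in_disc sigma_neq0
  (f m.+1) (fun i => f i.+1) _ _ lam0 lam0_disc _ G F x GT FT Dx).
- by apply: disc_of_geodesic; apply: f_geodesic; rewrite ltnSn.
- move=> i; apply: disc_of_geodesic; apply: f_geodesic.
  by apply/andP; split; [|exact: (ltnW (ltn_ord i))].
- suff -> : [tuple f i.+1 lam0 - f m.+1 lam0 | i < m] =
      [seq f j lam0 - f m.+1 lam0 | j <- index_iota 1 m.+1] :> seq _ by [].
  (* The index list is the enumeration of the ordinals below m, shifted by 1. *)
  rewrite /index_iota subSS subn0 (iotaDl 1 0) -val_enum_ord -2!map_comp.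
  exact: eq_map.
Qed.
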